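(* Let $X$ be a Banach function space, let $(\Omega,\Sigma)$ be a measurable space and let $m\colon\Sigma\to X$ be a $\sigma$-additive vector measure. Assume: (a) $X$ has the weak Banach-Saks property. (b) The measure $m$ is separable and positive, i.e. $m(A)\in X^+$ for every $A\in\Sigma$. (c) $L^1(m)$ has the subsequence splitting property. Then the Banach function space $L^1(m)$ has the weak Banach-Saks property.
   Context: All functions are real-valued. A Banach function space (B.f.s.) $X$ over a measure space $(S,\mathcal{S},\rho)$ is a Banach space of (a.e.-equivalence classes of) measurable functions on $S$ with the ideal property: if $f\in X$, $g$ is measurable and $|g|\le|f|$ $\rho$-a.e., then $g\in X$ and $\|g\|_X\le\|f\|_X$. $X^+$ is the cone of all $f\in X$ with $f\ge0$ a.e. $X$ has absolutely continuous (a.c.) norm if $\lim_{\rho(A)\to0}\|f\chi_A\|_X=0$ for every $f\in X$. A subset $K\subseteq X$ has uniformly a.c. norm if $\lim_{\rho(A)\to0}\sup_{f\in K}\|f\chi_A\|_X=0$. Subsequence splitting property: a B.f.s. $X$ has this property if $X$ has a.c. norm and for every norm bounded sequence $\{f_n\}\subseteq X$ there are a subsequence $\{f'_n\}$ of $\{f_n\}$ and sequences $\{g_n\},\{h_n\}$ in $X$ such that: (a) $f'_n=g_n+h_n$ with $g_n$ and $h_n$ having disjoint support, for each $n\in\mathbb{N}$; (b) $\{g_n\}$ has uniformly a.c. norm in $X$; (c) the functions $h_n$, $n\in\mathbb{N}$, have pairwise disjoint supports. Weak Banach-Saks property: a Banach space $Z$ has this property if every weakly null sequence in $Z$ admits a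 subsequence $\{z_n\}$ whose arithmetic means $\frac1n\sum_{k=1}^n z_k$ converge to zero in the norm of $Z$. The space $L^1(m)$: for $x^*\in X^*$ let $x^*m$ be the scalar measure $A\mapsto\langle x^*,m(A)\rangle$ and $|x^*m|$ its variation. The semivariation of $m$ is $\|m\|(A):=\sup\{|x^*m|(A):x^*\in B_{X^*}\}$, where $B_{X^*}$ is the closed unit ball of $X^*$. A measurable $f\colon\Omega\to\mathbb{R}$ is $m$-integrable if $f\in L^1(|x^*m|)$ for every $x^*\in X^*$ and for each $A\in\Sigma$ there is a vector $\int_A f\,dm\in X$ with $\langle\int_A f\,dm,x^*\rangle=\int_A f\,dx^*m$ for every $x^*\in X^*$. $L^1(m)$ is the space of $m$-integrable functions, identified when they agree $\|m\|$-a.e., with norm $\|f\|_{L^1(m)}:=\sup\{\int_\Omega|f|\,d|x^*m|:x^*\in B_{X^*}\}$. A Rybakov control measure for $m$ is a measure $\eta=|x_0^*m|$, $x_0^*\in X^*$, with $\eta(A)=0$ if and only if $\|m\|(A)=0$; such measures exist, and $L^1(m)$ is regarded as a B.f.s. over the finite measure space $(\Omega,\Sigma,\eta)$ for any Rybakov control measure $\eta$ (the choice is immaterial). The vector measure $m$ is separable if the pseudometric space $(\Sigma,d_m)$, $d_m(A,B):=\|m\|(A\triangle B)$, is separable, i.e. contains a countable dense subset. *)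

(* Defs.v *)
From HB Require Import structures.
From mathcomp Require Import all_boot all_order all_algebra.
From mathcomp Require Import generic_quotient ring_quotient.
From mathcomp Require Import all_classical all_reals all_analysis.
From mathcomp Require Import measurable_realfun ring lra.

Set Implicit Arguments.
Unset Strict Implicit.
Unset Printing Implicit Defensive.
Import Order.TTheory GRing.Theory Num.Def Num.Theory.
Import numFieldNormedType.Exports.
Local Open Scope classical_set_scope.
Local Open Scope ring_scope.
Local Open Scope quotient_scope.

Section cdual.
Context {R : realType}.
Variable X : normedModType R.

Definition dual_pred : {pred X -> R} :=
  fun f => `[< scalar f /\ continuous f >].

(* The topological dual X^*, with the operator norm. *)
Record cdual := Dual { dual_fun :> X -> R; dualP : dual_fun \in dual_pred }.

HB.instance Definition _ := [isSub for dual_fun].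
HB.instance Definition _ := [Choice of cdual by <:].

Lemma dual_pred_submod : submod_closed dual_pred.
Proof.
split.
  apply/asboolP; split; first by move=> a u v; rewrite /= [LHS]/0 mulr0 addr0.
  by move=> x; exact: cvg_cst.
move=> a f g /asboolP[lf cf] /asboolP[lg cg]; apply/asboolP; split.
  move=> b u v; have := lf b u v; have := lg b u v; rewrite /= => gE fE.
  change (a * f (b *: u + v) + g (b *: u + v) =
          b * (a * f u + g u) + (a * f v + g v)).
  by rewrite fE gE; ring.
by move=> x; apply: cvgD; [apply: cvgZr; exact: cf|exact: cg].
Qed.
HB.instance Definition _ :=
  GRing.isSubmodClosed.Build R (X -> R) dual_pred dual_pred_submod.
HB.instance Definition _ := [SubChoice_isSubLmodule of cdual by <:].

Lemma dual_scalar (phi : cdual) : scalar phi.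
Proof. by have /asboolP[] := dualP phi. Qed.
Lemma dual_continuous (phi : cdual) : continuous phi.
Proof. by have /asboolP[] := dualP phi. Qed.
HB.instance Definition _ (phi : cdual) :=
  GRing.isLinear.Build R X R *%R phi (dual_scalar phi).

Implicit Types (phi psi : cdual) (x : X).

Definition dual_norm (phi : cdual) : R := sup [set `|phi x| | x in [set x : X | `|x| <= 1]].


Lemma dual_bounded (phi : cdual) : exists2 M, 0 <= M & forall x, `|phi x| <= M * `|x|.
Proof.
have /linear_boundedP : bounded_near (phi : {linear X -> R}) (nbhs (0 : X)).
  by apply/linear_bounded_continuous => x; exact: dual_continuous.
by move=> /pinfty_ex_gt0[M M0 h]; exists M => //; exact: ltW.
Qed.

Let S (phi : cdual) := [set `|phi x| | x in [set x : X | `|x| <= 1]].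

Let has_supS phi : has_sup (S phi).
Proof.
split; first by exists `|phi 0|, 0 => //=; rewrite normr0.
have [M M0 h] := dual_bounded phi; exists M => _ [x /= x1 <-].
by rewrite (le_trans (h x))// ler_piMr.
Qed.

Lemma dual_norm_ub phi x : `|x| <= 1 -> `|phi x| <= dual_norm phi.
Proof. by move=> x1; apply: ub_le_sup; [exact: (has_supS phi).2|exists x]. Qed.

Lemma dual_norm_le phi M : (forall x, `|x| <= 1 -> `|phi x| <= M) -> dual_norm phi <= M.
Proof.
move=> h; apply: ge_sup; first exact: (has_supS phi).1.
by move=> _ [x /= x1 <-]; exact: h.
Qed.

Lemma dual_norm_ge0 phi : 0 <= dual_norm phi.
Proof. by apply: le_trans (@dual_norm_ub phi 0 _); rewrite ?normr0. Qed.

Lemma dual_normP phi x : `|phi x| <= dual_norm phi * `|x|.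
Proof.
have [->|x0] := eqVneq x 0; first by rewrite linear0 !normr0 mulr0.
have nx0 : 0 < `|x| by rewrite normr_gt0.
rewrite -ler_pdivrMr//.
have := @dual_norm_ub phi (`|x|^-1 *: x).
rewrite linearZ/= normrZ normrM normfV normr_id mulVf ?gt_eqF// => /(_ (lexx _)).
by rewrite mulrC.
Qed.

Lemma dual_addE (phi psi : cdual) x : (phi + psi) x = phi x + psi x.
Proof. by []. Qed.
Lemma dual_oppE (phi : cdual) x : (- phi) x = - phi x.
Proof. by []. Qed.
Lemma dual_scaleE a (phi : cdual) x : (a *: phi) x = a * phi x.
Proof. by []. Qed.

Lemma dual_ler_normD (phi psi : cdual) :
  dual_norm (phi + psi) <= dual_norm phi + dual_norm psi.
Proof.
apply: dual_norm_le => x x1; rewrite dual_addE (le_trans (ler_normD _ _))//.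
by rewrite lerD// dual_norm_ub.
Qed.

Lemma dual_normrZ a (phi : cdual) : dual_norm (a *: phi) = `|a| * dual_norm phi.
Proof.
have le_ b psi : dual_norm (b *: psi) <= `|b| * dual_norm psi.
  apply: dual_norm_le => x x1; rewrite dual_scaleE normrM.
  by rewrite ler_wpM2l// dual_norm_ub.
apply/eqP; rewrite eq_le le_/=.
have [->|a0] := eqVneq a 0; first by rewrite normr0 mul0r dual_norm_ge0.
rewrite -ler_pdivlMl ?normr_gt0// -normfV (le_trans _ (le_ _ _))//.
by rewrite scalerA mulVf// scale1r.
Qed.

Lemma dual_normr0_eq0 (phi : cdual) : dual_norm phi = 0 -> phi = 0.
Proof.
move=> n0; apply/val_inj/funext => x /=; apply/eqP; rewrite -normr_le0.
by rewrite (le_trans (dual_normP _ _))// n0 mul0r.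
Qed.

HB.instance Definition _ := Lmodule_isNormed.Build R cdual
  dual_ler_normD dual_normrZ dual_normr0_eq0.

Lemma dual_normE (phi : cdual) : `|phi| = dual_norm phi. Proof. by []. Qed.

Lemma dual_le (phi : cdual) x : `|phi x| <= `|phi| * `|x|.
Proof. exact: dual_normP. Qed.

Lemma dual_complete (F : set_system cdual) : ProperFilter F -> cauchy F -> cvg F.
Proof.
move=> FF Fc.
have Fxc x : cvg ((fun phi : cdual => phi x) @ F).
  apply: R_complete; apply/cauchy_ballP => e e0.
  have d0 : 0 < e / (`|x| + 1) by rewrite divr_gt0// ltr_pwDr.
  move/cauchy_ballP : Fc => /(_ _ d0) [[A B] /= [FA FB] AB].
  exists ([set phi x | phi in A], [set phi x | phi in B]) => /=.
    by split; [apply: filterS FA|apply: filterS FB] => phi ?; exists phi.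
  move=> [_ _] /= [[phi Aphi <-] [psi Bpsi <-]].
  have : ball phi (e / (`|x| + 1)) psi by exact: (AB (phi, psi)).
  rewrite -!ball_normE /ball_/= => h.
  have -> : phi x - psi x = (phi - psi) x by [].
  rewrite (le_lt_trans (dual_le _ _))//.
  rewrite (@le_lt_trans _ _ (`|phi - psi| * (`|x| + 1)))//.
    by rewrite ler_wpM2l// lerDl.
  by rewrite -ltr_pdivlMr// ltr_pwDr.
pose l x := lim ((fun phi : cdual => phi x) @ F).
have lx x : (fun phi : cdual => phi x) @ F --> l x by exact: Fxc.
have llin : scalar l.
  move=> a u v; apply: cvg_lim => //.
  rewrite (_ : (fun phi : cdual => phi (a *: u + v)) = (fun phi => a * phi u + phi v)).
    have h1 : (fun phi : cdual => a * phi u) @ F --> a * l u.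
      exact: (@cvgMl_tmp _ _ F _ _ a _ (lx u)).
    exact: (cvgD h1 (lx v)).
  by apply/funext => phi; rewrite linearP.
pose L : {linear X -> R} := HB.pack l (GRing.isLinear.Build _ _ _ _ l llin).
have close e : 0 < e -> F [set phi : cdual | forall x, `|l x - phi x| <= e * `|x|].
  move=> e0; move/cauchy_ballP : Fc => /(_ _ e0) [[A B] /= [FA FB] AB].
  have : F (A `&` B) by exact: filterI.
  apply: filterS => phi [Aphi Bphi] x.
  rewrite distrC.
  apply: (@closed_cvg _ _ F _ (fun psi : cdual => psi x)
     (closed_ball_ normr (phi x) (e * `|x|)) _ _ (l x) (lx x)).
  - exact: closed_closed_ball_.
  - near=> psi => /=.
    rewrite /closed_ball_/= distrC.
    have -> : psi x - phi x = (psi - phi) x by [].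
    rewrite (le_trans (dual_le _ _))// ler_wpM2r//.
    have : ball psi e phi by apply: (AB (psi, phi)); split => //=; near: psi.
    by rewrite -ball_normE => /ltW.
have [phi hphi] : exists phi : cdual, forall x, `|l x - phi x| <= 1 * `|x|.
  exact: filter_ex (close 1 ltr01).
have lc : continuous l.
  apply: (@linear_bounded_continuous _ _ _ L).1; apply/linear_boundedP.
  exists (1 + `|phi|); split => // r rb x.
  rewrite (@le_trans _ _ ((1 + `|phi|) * `|x|))//; last first.
    by rewrite ler_wpM2r// ltW.
  rewrite mulrDl -[L x](subrK (phi x)) (le_trans (ler_normD _ _))// lerD//.
  exact: dual_le.
have lP : l \in dual_pred by apply/asboolP.
apply/cvg_ex; exists (Dual lP); apply/cvgrPdist_le => e e0.
near=> psi; apply: dual_norm_le => x x1.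
have : `|l x - psi x| <= e * `|x| by move: x {x1}; near: psi; exact: close.
by move=> /le_trans; apply; rewrite ler_piMr// ltW.
Unshelve. all: by end_near. Qed.

HB.instance Definition _ := Uniform_isComplete.Build cdual dual_complete.

End cdual.

Section vector_measure.
Context {R : realType} d (Omega : measurableType d) (X : normedModType R).

Record vector_measure := VectorMeasure {
  vm_fun :> set Omega -> X;
  vm_sigma_additive : forall F : (set Omega)^nat,
    (forall i, measurable (F i)) -> trivIset setT F ->
    (fun n => \sum_(0 <= i < n) vm_fun (F i)) @ \oo --> vm_fun (\bigcup_i F i)
}.

Variable m : vector_measure.
Implicit Types (phi : cdual X) (f g : Omega -> R) (A : set Omega).

Lemma vm_set0 : m set0 = 0.
Proof.
have h := @vm_sigma_additive m (fun=> set0) (fun=> measurable0) (@trivIset_set0 _ _ _).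
have := @cvg_series_cvg_0 _ _ (fun=> m set0) (cvgP _ h).
by move=> /cvg_lim <-//; rewrite lim_cst.
Qed.

Definition scalar_measure phi A : \bar R := (phi (m A))%:E.

Let scalar_measure0 phi : scalar_measure phi set0 = 0%E.
Proof. by rewrite /scalar_measure vm_set0 linear0. Qed.

Let scalar_measure_fin phi A : measurable A -> scalar_measure phi A \is a fin_num.
Proof. by []. Qed.

Let scalar_measure_sigma_additive phi : semi_sigma_additive (scalar_measure phi).
Proof.
move=> F mF tF mUF.
have h : (phi (\sum_(0 <= i < n) m (F i))) @[n --> \oo] --> phi (m (\bigcup_i F i)).
  exact: (cvg_comp _ _ (vm_sigma_additive mF tF) (@dual_continuous _ _ phi _)).
rewrite (_ : (fun n => _) = (fun n => (phi (\sum_(0 <= i < n) m (F i)))%:E)).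
  by apply: cvg_EFin => //; exact: nearW.
by apply/funext => n; rewrite sumEFin linear_sum.
Qed.

HB.instance Definition _ phi := isCharge.Build _ _ _ (scalar_measure phi)
  (scalar_measure0 phi) (@scalar_measure_fin phi)
  (@scalar_measure_sigma_additive phi).

(* The Jordan decomposition, hence the variation |x^*m| and the integral
   against x^*m, does not depend on the Hahn decomposition chosen here. *)
Definition hahn_pos phi : set Omega :=
  sval (cid (Hahn_decomposition (scalar_measure phi))).
Definition hahn_neg phi : set Omega :=
  sval (cid (svalP (cid (Hahn_decomposition (scalar_measure phi))))).
Definition hahn_posneg phi :
    hahn_decomposition (scalar_measure phi) (hahn_pos phi) (hahn_neg phi) :=
  svalP (cid (svalP (cid (Hahn_decomposition (scalar_measure phi))))).

Definition scalar_variation phi : {measure set Omega -> \bar R} :=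
  charge_variation (hahn_posneg phi).

Definition semivariation A : \bar R :=
  ereal_sup [set scalar_variation phi A | phi in [set phi : cdual X | `|phi| <= 1]].

(* \int_A f dx^*m for the signed measure x^*m; only meaningful when
   f is in L^1(|x^*m|), which vm_integrable requires. *)
Definition scalar_integral phi A f : R :=
  \int[jordan_pos (hahn_posneg phi)]_(w in A) f w -
  \int[jordan_neg (hahn_posneg phi)]_(w in A) f w.

Definition vm_integrable f : Prop :=
  [/\ measurable_fun setT f,
      forall phi, (scalar_variation phi).-integrable setT (EFin \o f) &
      forall A, measurable A ->
        exists v : X, forall phi, phi v = scalar_integral phi A f].

(* \bar R-valued L^1(m) norm; finite on m-integrable functions, see
   L1_enorm_lty. *)
Definition L1_enorm f : \bar R :=
  ereal_sup [set (\int[scalar_variation phi]_w `|(f w)%:E|)%E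
            | phi in [set phi : cdual X | `|phi| <= 1]].

Let le_normr_RintegralT (mu : {measure set Omega -> \bar R}) f A :
  measurable A -> mu.-integrable setT (EFin \o f) ->
  `|\int[mu]_(w in A) f w| <= \int[mu]_w `|f w|.
Proof.
move=> mA intf; have intA := integrableS measurableT mA (@subsetT _ A) intf.
rewrite (le_trans (le_normr_Rintegral mA intA))//.
rewrite /Rintegral fine_le//.
- by apply: integrable_fin_num => //; exact: integrable_norm.
- by apply: integrable_fin_num => //; exact: integrable_norm.
- apply: ge0_subset_integral => //.
  exact: measurable_int (integrable_norm intf).
Qed.

Let jp phi := jordan_pos (hahn_posneg phi).
Let jn phi := jordan_neg (hahn_posneg phi).

Lemma measurable_abseE f : measurable_fun setT f ->
  measurable_fun setT (fun w => `|(f w)%:E|%E).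
Proof.
move=> mf; have mfE : measurable_fun setT (EFin \o f) by exact/measurable_EFinP.
exact: measurableT_comp mfE.
Qed.

Lemma integral_scalar_variation phi (g : Omega -> \bar R) : measurable_fun setT g ->
  (forall w, 0 <= g w)%E ->
  (\int[scalar_variation phi]_w g w = \int[jp phi]_w g w + \int[jn phi]_w g w)%E.
Proof.
move=> mg g0; rewrite (eq_measure_integral (measure_add (jp phi) (jn phi))).
  by rewrite ge0_integral_measure_add.
by move=> A mA _; symmetry; exact: measure_addE.
Qed.

Lemma scalar_variation_integrable phi f :
  (scalar_variation phi).-integrable setT (EFin \o f) ->
  (jp phi).-integrable setT (EFin \o f) /\ (jn phi).-integrable setT (EFin \o f).
Proof.
move=> /integrableP[mf].
rewrite integral_scalar_variation//; last exact: measurableT_comp.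
have p0 : (0 <= \int[jp phi]_w `|(EFin \o f) w|)%E by exact: integral_ge0.
have n0 : (0 <= \int[jn phi]_w `|(EFin \o f) w|)%E by exact: integral_ge0.
by move=> h; split; apply/integrableP; split => //;
  apply: le_lt_trans h; rewrite ?leeDl ?leeDr.
Qed.

Lemma vm_integrableD f g : vm_integrable f -> vm_integrable g ->
  vm_integrable (f \+ g).
Proof.
move=> [mf vf intf] [mg vg intg]; split; first exact: measurable_funD.
  move=> phi; rewrite (_ : EFin \o _ = ((EFin \o f) \+ (EFin \o g))%E)//.
  exact: integrableD.
move=> A mA; have [u uE] := intf A mA; have [v vE] := intg A mA.
exists (u + v) => phi; have -> : phi (u + v) = phi u + phi v by exact: linearD.
rewrite uE vE /scalar_integral.
have [fp fn] := scalar_variation_integrable (vf phi).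
have [gp gn] := scalar_variation_integrable (vg phi).
rewrite !RintegralD//; try by apply: integrableS (subsetT A) _.
by ring.
Qed.

Lemma vm_integrableZ a f : vm_integrable f -> vm_integrable (fun w => a * f w).
Proof.
move=> [mf vf intf]; split; first exact: measurable_funM.
  by move=> phi; rewrite (_ : EFin \o _ = fun w => (a%:E * (EFin \o f) w)%E)//; exact: integrableZl.
move=> A mA; have [u uE] := intf A mA.
exists (a *: u) => phi; have -> : phi (a *: u) = a * phi u by exact: linearZ.
rewrite uE /scalar_integral.
have [fp fn] := scalar_variation_integrable (vf phi).
rewrite !RintegralZl//; try by apply: integrableS (subsetT A) _.
by rewrite /= mulrBr.
Qed.

Lemma vm_integrable0 : vm_integrable (fun=> 0).
Proof.
split; [exact: measurable_cst|by move=> phi; exact: integrable0|].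
move=> A mA; exists 0 => phi; rewrite linear0 /scalar_integral.
by rewrite !Rintegral_cst// !mul0r subrr.
Qed.

(* Uniform boundedness on the dual; this is what makes the L^1(m) norm finite. *)
Lemma scalar_integral_bounded f : vm_integrable f -> exists M : R,
  forall phi A, `|phi| <= 1 -> measurable A -> `|scalar_integral phi A f| <= M.
Proof.
move=> [mf vf intf].
pose B := [set v : X | exists2 A, measurable A &
  forall phi, phi v = scalar_integral phi A f].
pose F := [set (fun phi : cdual X => phi v : R) | v in B].
have FP : forall T : cdual X -> R, F T -> bounded_fun_norm T /\ linear T.
  move=> _ [v Bv <-]; split => // r.
  exists (r * `|v|) => phi phir; rewrite (le_trans (dual_le _ _))//.
  by rewrite ler_wpM2r.
have Fpt : pointwise_bounded F.
  move=> phi; have [fp fn] := scalar_variation_integrable (vf phi).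
  exists ((\int[jp phi]_w `|f w|) + (\int[jn phi]_w `|f w|)).
  move=> _ [v [A mA vE] <-]; rewrite vE /scalar_integral.
  rewrite (le_trans (ler_normB _ _))// lerD//.
    exact: le_normr_RintegralT.
  exact: le_normr_RintegralT.
have [M hM] := Banach_Steinhauss FP Fpt 1.
exists M => phi A phi1 mA; have [v vE] := intf A mA.
rewrite -vE; apply: (hM (fun phi => phi v)) => //.
by exists v => //; exists A.
Qed.

Lemma jordan_pos_neg0 phi : jp phi (hahn_neg phi) = 0%E.
Proof.
have [_ [mN _] _ PN0] := hahn_posneg phi.
rewrite /jp jordan_posE /= /charge.cjordan_pos.
by rewrite /crestr0 mem_set// /crestr setIC PN0 charge0.
Qed.

Lemma jordan_neg_pos0 phi : jn phi (hahn_pos phi) = 0%E.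
Proof.
have [[mP _] _ _ PN0] := hahn_posneg phi.
rewrite /jn jordan_negE /= charge.cjordan_negE.
by rewrite /crestr0 mem_set// /crestr PN0 charge0 oppe0.
Qed.

Lemma integral_abs_le (mu nu : {measure set Omega -> \bar R}) (P N : set Omega) f (M : R) :
  measurable P -> measurable N -> P `|` N = setT -> P `&` N = set0 ->
  mu N = 0%E -> nu P = 0%E ->
  mu.-integrable setT (EFin \o f) ->
  (forall A, measurable A ->
     `|\int[mu]_(w in A) f w - \int[nu]_(w in A) f w| <= M) ->
  (\int[mu]_w `|(f w)%:E| <= (M + M)%:E)%E.
Proof.
move=> mP mN PNT PN0 muN nuP intf hM.
have mf : measurable_fun setT (EFin \o f) by exact: (measurable_int mu).
have mfR : measurable_fun setT f by exact/measurable_EFinP.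
have null (A : set Omega) (g : Omega -> R) (la : {measure set Omega -> \bar R}) :
    measurable A -> la A = 0%E -> measurable_fun setT g -> \int[la]_(w in A) g w = 0.
  move=> mA laA mg; rewrite /Rintegral null_set_integral//.
  by apply: measurable_funTS; exact/measurable_EFinP.
pose E := [set w | 0 <= f w].
have mE : measurable E.
  rewrite (_ : E = f @^-1` `[0, +oo[); last first.
    by apply/seteqP; split => w /=; rewrite in_itv/= andbT.
  by rewrite -[X in measurable X]setTI; exact: mfR.
have nuS A : measurable A -> A `<=` P -> nu A = 0%E.
  by move=> mA AP; apply: subset_measure0 nuP.
have mPE : measurable (P `&` E) by exact: measurableI.
have mPE' : measurable (P `&` ~` E) by apply: measurableI => //; exact: measurableC.
have iabs : mu.-integrable setT (fun w => `|f w|%:E) by exact: integrable_norm.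
have iS (A : set Omega) (g : Omega -> R) : measurable A ->
    mu.-integrable setT (EFin \o g) -> mu.-integrable A (EFin \o g).
  by move=> mA; apply: integrableS.
have -> : (\int[mu]_w `|(f w)%:E| = (\int[mu]_w `|f w|)%:E)%E.
  by rewrite /Rintegral fineK//; exact: integrable_fin_num.
rewrite lee_fin -PNT Rintegral_setU//; last 2 first.
  by rewrite PNT.
  by apply/disj_setPS; rewrite PN0.
rewrite (null N (fun w => `|f w|))//; last exact: measurableT_comp.
rewrite addr0 -(setIT P) -(setUv E) setIUr Rintegral_setU//; last 2 first.
  by apply: iS => //; exact: measurableU.
  by apply/disj_setPS; rewrite setIACA setICr setI0.
apply: lerD.
- rewrite (@eq_Rintegral _ _ _ mu _ f); last first.
    by move=> w /set_mem[_ /= fw]; rewrite ger0_norm.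
  have := hM _ mPE; rewrite [X in _ - X]null//; last by apply: nuS => // ? [].
  by rewrite subr0; apply: le_trans; exact: ler_norm.
- rewrite (@eq_Rintegral _ _ _ mu _ (fun w => -1 * f w)); last first.
    move=> w /set_mem[_ /= /negP]; rewrite -ltNge => fw.
    by rewrite ltr0_norm// mulN1r.
  rewrite RintegralZl//; last exact: iS.
  have := hM _ mPE'; rewrite [X in _ - X]null//; last by apply: nuS => // ? [].
  by rewrite subr0 mulN1r; apply: le_trans; rewrite -normrN; exact: ler_norm.
Qed.

Lemma L1_enorm_lty f : vm_integrable f -> (L1_enorm f < +oo)%E.
Proof.
move=> intf; have [M hM] := scalar_integral_bounded intf.
have [mf vf _] := intf.
apply: (@le_lt_trans _ _ ((M + M) + (M + M))%:E); last exact: ltry.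
apply: ge_ereal_sup => _ [phi /= phi1 <-].
have [[mP _] [mN _] PNT PN0] := hahn_posneg phi.
have [fp fn] := scalar_variation_integrable (vf phi).
rewrite integral_scalar_variation//; last first.
  exact: measurable_abseE.
rewrite EFinD leeD//.
- apply: (@integral_abs_le _ (jn phi) (hahn_pos phi) (hahn_neg phi)) => //.
  + exact: jordan_pos_neg0.
  + exact: jordan_neg_pos0.
  + by move=> A mA; exact: hM.
- apply: (@integral_abs_le _ (jp phi) (hahn_neg phi) (hahn_pos phi)) => //.
  + by rewrite setUC.
  + by rewrite setIC.
  + exact: jordan_neg_pos0.
  + exact: jordan_pos_neg0.
  + by move=> A mA; rewrite distrC; exact: hM.
Qed.

Lemma L1_enorm_ge0 f : (0 <= L1_enorm f)%E.
Proof.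
have h : (\int[scalar_variation 0%R]_w `|(f w)%:E| <= L1_enorm f)%E.
  by apply: ereal_sup_ubound; exists 0%R => //=; rewrite normr0.
by apply: le_trans h; exact: integral_ge0.
Qed.

Lemma L1_enorm_fin f : vm_integrable f -> L1_enorm f \is a fin_num.
Proof. by move=> h; rewrite ge0_fin_numE ?L1_enorm_ge0 ?L1_enorm_lty. Qed.

Lemma L1_enormD f g : measurable_fun setT f -> measurable_fun setT g ->
  (L1_enorm (fun w => (f w + g w)%R) <= L1_enorm f + L1_enorm g)%E.
Proof.
move=> mf mg; apply: ge_ereal_sup => _ [phi /= phi1 <-].
have mE := measurable_abseE.
rewrite (@le_trans _ _ (\int[scalar_variation phi]_w (`|(f w)%:E| + `|(g w)%:E|))%E)//.
  apply: ge0_le_integral => //.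
  - by have /mE : measurable_fun setT (f \+ g) by exact: measurable_funD.
  - by apply: emeasurable_funD; exact: mE.
  - by move=> w _; exact: (lee_abs_add (f w)%:E (g w)%:E).
rewrite ge0_integralD//; try exact: mE.
by rewrite leeD//; apply: ereal_sup_ubound; exists phi.
Qed.

Lemma L1_enormZ a f : measurable_fun setT f ->
  (L1_enorm (fun w => (a * f w)%R) = `|a|%:E * L1_enorm f)%E.
Proof.
move=> mf.
have le_ (b : R) (h : Omega -> R) : measurable_fun setT h ->
    (L1_enorm (fun w => (b * h w)%R) <= `|b|%:E * L1_enorm h)%E.
  move=> mh; apply: ge_ereal_sup => _ [phi /= phi1 <-].
  under eq_integral do rewrite /= normrM EFinM.
  rewrite ge0_integralZl//; last first.
    exact: measurable_abseE.
  by rewrite lee_wpmul2l//; apply: ereal_sup_ubound; exists phi.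
apply/eqP; rewrite eq_le le_//=.
have [->|a0] := eqVneq a 0; first by rewrite normr0 mul0e L1_enorm_ge0.
have := le_ a^-1 (fun w => a * f w) (measurable_funM (measurable_cst _) mf).
rewrite (_ : (fun w => a^-1 * (a * f w)) = f); last first.
  by apply/funext => w; rewrite mulrA mulVf// mul1r.
by rewrite normfV -lee_pdivlMl ?normr_gt0// ?invr_gt0 ?normr_gt0// invrK.
Qed.

(* Equality ||m||-a.e. For measurable f and g the set where they differ is
   measurable. *)
Definition vm_ae_eq f g : Prop := semivariation [set w | f w != g w] = 0%E.

Lemma semivariation_ge0 A : (0 <= semivariation A)%E.
Proof.
have h : (scalar_variation 0%R A <= semivariation A)%E.
  by apply: ereal_sup_ubound; exists 0%R => //=; rewrite normr0.
by apply: le_trans h; exact: measure_ge0.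
Qed.

Lemma semivariation0P A : semivariation A = 0%E <->
  forall phi, `|phi| <= 1 -> scalar_variation phi A = 0%E.
Proof.
split=> [h phi phi1|h].
  apply/eqP; rewrite eq_le measure_ge0 andbT -h.
  by apply: ereal_sup_ubound; exists phi.
apply/eqP; rewrite eq_le semivariation_ge0 andbT.
by apply: ge_ereal_sup => _ [phi /= phi1 <-]; rewrite h.
Qed.

Lemma measurable_neq f g : measurable_fun setT f -> measurable_fun setT g ->
  measurable [set w | f w != g w].
Proof.
move=> mf mg; rewrite (_ : [set w | _] = (fun w => f w - g w) @^-1` (~` [set 0])).
  rewrite -[X in measurable X]setTI; apply: (measurable_funB mf mg) => //.
  exact: measurableC.
by apply/seteqP; split => w /=; rewrite -subr_eq0 => /eqP.
Qed.

Lemma vm_ae_eqP f g : measurable_fun setT f -> measurable_fun setT g ->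
  vm_ae_eq f g <->
  forall phi, `|phi| <= 1 -> {ae scalar_variation phi, forall w, f w = g w}.
Proof.
move=> mf mg; have mN := measurable_neq mf mg.
have E : ~` [set w | f w = g w] = [set w | f w != g w].
  by apply/seteqP; split => w /= /eqP.
rewrite /vm_ae_eq semivariation0P; split=> h phi phi1.
  change ((scalar_variation phi).-negligible (~` [set w | f w = g w])).
  by rewrite E; apply/negligibleP => //; exact: h.
have : (scalar_variation phi).-negligible (~` [set w | f w = g w]) by exact: h.
by rewrite E => /negligibleP; exact.
Qed.

Lemma L1_enorm_ae f g : measurable_fun setT f -> measurable_fun setT g ->
  vm_ae_eq f g -> L1_enorm f = L1_enorm g.
Proof.
move=> mf mg /vm_ae_eqP => /(_ mf mg) h.
rewrite /L1_enorm; congr ereal_sup; apply: eq_imagel => phi /= phi1.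
apply: ge0_ae_eq_integral => //.
- exact: measurable_abseE.
- exact: measurable_abseE.
- by apply: filterS (h _ phi1) => w /= ->.
Qed.

Lemma L1_enorm0_ae f : measurable_fun setT f -> L1_enorm f = 0%E ->
  vm_ae_eq f (fun=> 0).
Proof.
move=> mf f0; apply/vm_ae_eqP => // phi phi1.
have mfE : measurable_fun setT (EFin \o f) by exact/measurable_EFinP.
have /(ae_eq_integral_abs _ measurableT mfE) : (\int[scalar_variation phi]_w `|(EFin \o f) w| = 0)%E.
  apply/eqP; rewrite eq_le integral_ge0// andbT -f0.
  by apply: ereal_sup_ubound; exists phi.
by apply: filterS => w /= /(_ I) [].
Qed.

End vector_measure.

Section L1.
Context {R : realType} d (Omega : measurableType d) (X : normedModType R).
Variable m : vector_measure Omega X.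

Definition L1_pred : {pred Omega -> R} := fun f => `[< vm_integrable m f >].

Record L1fun := L1Fun { L1fun_val :> Omega -> R; L1funP : L1fun_val \in L1_pred }.

HB.instance Definition _ := [isSub for L1fun_val].
HB.instance Definition _ := [Choice of L1fun by <:].

Lemma L1_pred_submod : submod_closed L1_pred.
Proof.
split; first by apply/asboolP; exact: vm_integrable0.
move=> a f g /asboolP fi /asboolP gi; apply/asboolP.
exact: (vm_integrableD (vm_integrableZ a fi) gi).
Qed.
HB.instance Definition _ :=
  GRing.isSubmodClosed.Build R (Omega -> R) L1_pred L1_pred_submod.
HB.instance Definition _ := [SubChoice_isSubLmodule of L1fun by <:].

Lemma L1fun_integrable (f : L1fun) : vm_integrable m f.
Proof. by have /asboolP := L1funP f. Qed.

Lemma L1fun_measurable (f : L1fun) : measurable_fun setT f.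
Proof. by have [] := L1fun_integrable f. Qed.

Definition L1_null : {pred L1fun} := fun f => `[< vm_ae_eq m f (fun=> 0) >].

Lemma L1_nullP (f : L1fun) : reflect
  (forall phi : cdual X, `|phi| <= 1 -> {ae scalar_variation m phi, forall w, f w = 0})
  (f \in L1_null).
Proof.
apply: (iffP idP) => [/asboolP/vm_ae_eqP h|h].
  by apply: h; [exact: L1fun_measurable|exact: measurable_cst].
apply/asboolP/vm_ae_eqP => //; exact: L1fun_measurable.
Qed.

Lemma L1_null_zmod : zmod_closed L1_null.
Proof.
split; first by apply/L1_nullP => phi _; exact: aeW.
move=> f g /L1_nullP f0 /L1_nullP g0; apply/L1_nullP => phi phi1.
have := g0 _ phi1; have := f0 _ phi1; apply: filterS2 => w fw gw.
by change (f w - g w = 0); rewrite fw gw subrr.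
Qed.
HB.instance Definition _ := GRing.isZmodClosed.Build L1fun L1_null L1_null_zmod.

Lemma L1_nullZ a (f : L1fun) : f \in L1_null -> a *: f \in L1_null.
Proof.
move=> /L1_nullP f0; apply/L1_nullP => phi phi1.
apply: filterS (f0 _ phi1) => w fw.
by change (a * f w = 0); rewrite fw mulr0.
Qed.

(* L^1(m): m-integrable functions modulo ||m||-a.e. equality, see L1_classP. *)
Definition L1 : Type := Quotient.quot L1_null.
HB.instance Definition _ := GRing.Zmodule.on L1.
HB.instance Definition _ := EqQuotient.on L1.

Definition L1_class (f : L1fun) : L1 := \pi_L1 f.
Definition L1_repr (x : L1) : L1fun := repr x.

Lemma L1_reprK x : L1_class (L1_repr x) = x.
Proof. exact: reprK. Qed.

Lemma L1_classP (f g : L1fun) : L1_class f = L1_class g <-> vm_ae_eq m f g.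
Proof.
have -> : L1_class f = L1_class g <-> f - g \in L1_null.
  by split => [/eqmodP|h]; [|apply/eqmodP].
split=> [/L1_nullP h|/vm_ae_eqP h].
  apply/vm_ae_eqP; [exact: L1fun_measurable|exact: L1fun_measurable|].
  move=> phi phi1; apply: filterS (h _ phi1) => w fg.
  by apply/eqP; rewrite -subr_eq0; apply/eqP.
apply/L1_nullP => phi phi1.
apply: filterS (h (L1fun_measurable f) (L1fun_measurable g) phi phi1) => w fg.
by change (f w - g w = 0); rewrite fg subrr.
Qed.

Lemma L1_class_repr f : vm_ae_eq m (L1_repr (L1_class f)) f.
Proof. by apply/L1_classP; rewrite L1_reprK. Qed.

Lemma L1_classD f g : L1_class (f + g) = L1_class f + L1_class g.
Proof. exact: Quotient.pi_add. Qed.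

Definition L1_scale a (x : L1) : L1 := L1_class (a *: L1_repr x).

Lemma L1_classZ a f : L1_class (a *: f) = L1_scale a (L1_class f).
Proof.
apply/eqmodP; change (a *: f - a *: L1_repr (L1_class f) \in L1_null).
rewrite -scalerBr; apply: L1_nullZ.
by have /esym /eqmodP := L1_reprK (L1_class f).
Qed.

Lemma L1_ex (x : L1) : exists f, x = L1_class f.
Proof. by exists (L1_repr x); rewrite L1_reprK. Qed.

Lemma L1_scaleA a b x : L1_scale a (L1_scale b x) = L1_scale (a * b) x.
Proof. by have [f ->] := L1_ex x; rewrite -!L1_classZ scalerA. Qed.
Lemma L1_scale1 : left_id 1 L1_scale.
Proof. by move=> x; have [f ->] := L1_ex x; rewrite -L1_classZ scale1r. Qed.
Lemma L1_scaleDr : right_distributive L1_scale +%R.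
Proof.
move=> a x y; have [f ->] := L1_ex x; have [g ->] := L1_ex y.
by rewrite -!L1_classZ -!L1_classD -L1_classZ scalerDr.
Qed.
Lemma L1_scaleDl x : {morph L1_scale^~ x : a b / a + b}.
Proof.
move=> a b; have [f ->] := L1_ex x.
by rewrite -!L1_classZ scalerDl L1_classD.
Qed.
HB.instance Definition _ := GRing.Zmodule_isLmodule.Build R L1
  L1_scaleA L1_scale1 L1_scaleDr L1_scaleDl.

Definition L1_norm (x : L1) : R := fine (L1_enorm m (L1_repr x)).

Lemma L1_norm_class f : (L1_norm (L1_class f))%:E = L1_enorm m f.
Proof.
rewrite /L1_norm fineK; last exact/L1_enorm_fin/L1fun_integrable.
apply: L1_enorm_ae; [exact: L1fun_measurable|exact: L1fun_measurable|].
exact: L1_class_repr.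
Qed.

Lemma L1_ler_normD x y : L1_norm (x + y) <= L1_norm x + L1_norm y.
Proof.
have [f ->] := L1_ex x; have [g ->] := L1_ex y.
rewrite -L1_classD -lee_fin EFinD !L1_norm_class.
exact: (L1_enormD m (L1fun_measurable _) (L1fun_measurable _)).
Qed.

Lemma L1_normrZ a x : L1_norm (a *: x) = `|a| * L1_norm x.
Proof.
have [f ->] := L1_ex x.
change (L1_norm (L1_scale a (L1_class f)) = `|a| * L1_norm (L1_class f)).
apply: EFin_inj; rewrite -L1_classZ EFinM !L1_norm_class.
exact: (L1_enormZ m a (L1fun_measurable _)).
Qed.

Lemma L1_normr0_eq0 x : L1_norm x = 0 -> x = 0.
Proof.
have [f ->] := L1_ex x; move=> h0.
have h : L1_enorm m f = 0%E by rewrite -L1_norm_class h0.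
have -> : (0 : L1) = L1_class 0 by exact/esym/pi_zeror.
apply: (L1_classP f 0).2.
exact: (L1_enorm0_ae (L1fun_measurable f) h).
Qed.

HB.instance Definition _ := Lmodule_isNormed.Build R L1
  L1_ler_normD L1_normrZ L1_normr0_eq0.

Lemma L1_normE (x : L1) : (`|x|%:E = L1_enorm m (L1_repr x))%E.
Proof. by rewrite -L1_norm_class L1_reprK. Qed.

End L1.

Section L1_rybakov.
Context {R : realType} d (Omega : measurableType d) (X : normedModType R).
Variable m : vector_measure Omega X.

Definition rybakov (phi : cdual X) : Prop := forall A, measurable A ->
  scalar_variation m phi A = 0%E <-> semivariation m A = 0%E.

Lemma rybakov_aeP (phi : cdual X) (f g : Omega -> R) : rybakov phi ->
  measurable_fun setT f -> measurable_fun setT g ->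
  {ae scalar_variation m phi, forall w, f w = g w} <-> vm_ae_eq m f g.
Proof.
move=> ryb mf mg; have mN := measurable_neq mf mg.
have E : ~` [set w | f w = g w] = [set w | f w != g w].
  by apply/seteqP; split => w /= /eqP.
rewrite /vm_ae_eq -(ryb _ mN).
split=> [h|h].
  have : (scalar_variation m phi).-negligible (~` [set w | f w = g w]) by exact: h.
  by rewrite E => /negligibleP; exact.
change ((scalar_variation m phi).-negligible (~` [set w | f w = g w])).
by rewrite E; apply/negligibleP.
Qed.

End L1_rybakov.

Section function_spaces.
Context {R : realType} d (S : measurableType d).
Variable rho : {measure set S -> \bar R}.

(* A normed space Z of rho-a.e. classes of measurable functions: fs_fun picks
   a representative of each class, so it is linear and injective only up to
   rho-a.e. equality. *)
Record function_space (Z : normedModType R) := FunctionSpace {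
  fs_fun :> Z -> S -> R;
  fs_measurable : forall z, measurable_fun setT (fs_fun z);
  fs_linear : forall a y z, {ae rho, forall s,
    fs_fun (a *: y + z) s = a * fs_fun y s + fs_fun z s};
  fs_inj : forall z, {ae rho, forall s, fs_fun z s = 0} -> z = 0
}.

Record banach_function_space (X : completeNormedModType R) :=
  BanachFunctionSpace {
    bfs_function_space :> function_space X;
    bfs_ideal : forall (x : X) (g : S -> R), measurable_fun setT g ->
      {ae rho, forall s, `|g s| <= `|bfs_function_space x s|} ->
      exists y : X, {ae rho, forall s, bfs_function_space y s = g s} /\
        `|y| <= `|x|
  }.

Section notions.
Variables (Z : normedModType R) (F : function_space Z).

Definition fs_ge0 (z : Z) : Prop := {ae rho, forall s, 0 <= F z s}.

(* The element z \chi_A of Z; the default value 0 is never used when Z has the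
   ideal property, nor for L^1(m), see bfs_restrictP and L1_restrictP. *)
Definition fs_restrict (z : Z) (A : set S) : Z :=
  xget 0 [set y | {ae rho, forall s, F y s = (F z \_ A) s}].

Definition ac_norm : Prop := forall z : Z, forall e : R, 0 < e ->
  exists2 delta : R, 0 < delta & forall A, measurable A ->
    (rho A < delta%:E)%E -> `|fs_restrict z A| <= e.

Definition uniformly_ac_norm (K : set Z) : Prop := forall e : R, 0 < e ->
  exists2 delta : R, 0 < delta & forall A, measurable A ->
    (rho A < delta%:E)%E -> forall z, K z -> `|fs_restrict z A| <= e.

Definition disjoint_support (y z : Z) : Prop :=
  {ae rho, forall s, F y s = 0 \/ F z s = 0}.

Definition subsequence_splitting : Prop := ac_norm /\
  forall f : nat -> Z, (exists M : R, forall n, `|f n| <= M) ->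
  exists (s : nat -> nat) (g h : nat -> Z),
    [/\ {homo s : i j / (i < j)%N},
        forall n, f (s n) = g n + h n /\ disjoint_support (g n) (h n),
        uniformly_ac_norm (range g) &
        forall i j, i != j -> disjoint_support (h i) (h j)].

End notions.

Lemma bfs_restrictP (X : completeNormedModType R)
    (F : banach_function_space X) (x : X) (A : set S) : measurable A ->
  {ae rho, forall s, F (fs_restrict F x A) s = (F x \_ A) s}.
Proof.
move=> mA; rewrite /fs_restrict; case: xgetP => [y _ //|/= h].
have mg : measurable_fun setT (F x \_ A).
  exact: (measurable_restrictT _ mA).1 (measurable_funTS (fs_measurable F x)).
have gle : {ae rho, forall s, `|(F x \_ A) s| <= `|F x s|}.
  by apply: aeW => s; rewrite patchE; case: ifP => // _; rewrite normr0.
by have [y [yE _]] := bfs_ideal mg gle; case: (h y).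
Qed.

End function_spaces.

Section weak_banach_saks.
Context {R : realType} (Z : normedModType R).

Definition weakly_null (z : nat -> Z) : Prop :=
  forall phi : cdual Z, (fun n => phi (z n)) @ \oo --> (0 : R).

(* Stated for normed spaces; completeness plays no role in the definition. *)
Definition weak_banach_saks : Prop :=
  forall z : nat -> Z, weakly_null z ->
  exists2 s : nat -> nat, {homo s : i j / (i < j)%N} &
    (fun n => n.+1%:R^-1 *: \sum_(k < n.+1) z (s k)) @ \oo --> (0 : Z).

End weak_banach_saks.

Section vector_measure_properties.
Context {R : realType} d (Omega : measurableType d) (X : normedModType R).
Variable m : vector_measure Omega X.

Definition vm_separable : Prop := exists D : set (set Omega),
  [/\ countable D, D `<=` measurable &
      forall A, measurable A -> forall e : R, 0 < e ->
        exists2 B, D B & (semivariation m ((A `\` B) `|` (B `\` A)) < e%:E)%E].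

Definition vm_positive d' (S : measurableType d')
    (rho : {measure set S -> \bar R}) (F : function_space rho X) : Prop :=
  forall A, measurable A -> fs_ge0 F (m A).

Variables (phi : cdual X) (ryb : rybakov m phi).

Let L1_fs_linear (a : R) (y z : L1 m) :
  {ae scalar_variation m phi, forall w,
    L1_repr (a *: y + z) w = a * L1_repr y w + L1_repr z w}.
Proof.
have h := L1_class_repr (a *: L1_repr y + L1_repr z).
have E : L1_class (a *: L1_repr y + L1_repr z) = a *: y + z.
  by rewrite L1_classD L1_reprK.
rewrite E in h.
exact: (rybakov_aeP ryb (L1fun_measurable _)
  (L1fun_measurable (a *: L1_repr y + L1_repr z))).2 h.
Qed.

Let L1_fs_inj (z : L1 m) :
  {ae scalar_variation m phi, forall w, L1_repr z w = 0} -> z = 0.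
Proof.
move=> /(rybakov_aeP ryb) h; rewrite -[z]L1_reprK.
have -> : (0 : L1 m) = L1_class (0 : L1fun m) by exact/esym/pi_zeror.
apply: (L1_classP _ _).2; apply: h; first exact: L1fun_measurable.
exact: measurable_cst.
Qed.

(* L^1(m) as a function space over the finite measure |phi m|, for phi a
   Rybakov functional. *)
Definition L1_function_space :
    function_space (scalar_variation m phi) (L1 m) :=
  FunctionSpace (fun z => L1fun_measurable (L1_repr z)) L1_fs_linear L1_fs_inj.

Lemma L1_restrictP (z : L1 m) (A : set Omega) : measurable A ->
  {ae scalar_variation m phi, forall w,
    L1_function_space (fs_restrict L1_function_space z A) w =
    (L1_function_space z \_ A) w}.
Proof.
move=> mA; rewrite /fs_restrict; case: xgetP => [y _ //|/= h].
have [mf vf intf] := L1fun_integrable (L1_repr z).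
have fA : vm_integrable m (L1_repr z \_ A).
  split.
  - exact: (measurable_restrictT _ mA).1 (measurable_funTS mf).
  - move=> psi; rewrite -restrict_EFin; apply/(integrable_mkcond _ mA).
    exact: integrableS (vf psi).
  - move=> B mB; have [|v vE] := intf (B `&` A); first exact: measurableI.
    by exists v => psi; rewrite vE /scalar_integral !Rintegral_mkcondr.
have fA' : (L1_repr z \_ A) \in L1_pred m by apply/asboolP.
case: (h (L1_class (L1Fun fA'))).
apply/(rybakov_aeP ryb); first exact: L1fun_measurable.
  by have [] := fA.
exact: (L1_class_repr (L1Fun fA')).
Qed.

End vector_measure_properties.

(* Main.v *)
Require Import Defs.
From HB Require Import structures.
From mathcomp Require Import all_boot all_order all_algebra.
From mathcomp Require Import all_classical all_reals all_analysis.
From mathcomp Require Import measurable_realfun ring lra.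

Set Implicit Arguments.
Unset Strict Implicit.
Unset Printing Implicit Defensive.
Import Order.TTheory GRing.Theory Num.Theory.
Import numFieldNormedType.Exports.
Local Open Scope classical_set_scope.
Local Open Scope ring_scope.

(** A weakly null sequence in L^1(m) is bounded, hence by subsequence splitting
    it has a subsequence of the form g_n + h_n with (g_n) of uniformly
    absolutely continuous norm and (h_n) pairwise disjoint. Three facts then
    produce norm null Cesaro means.

    Both (g_n) and (h_n) are weakly null ([splitting_weakly_null]): outside the
    supports of h_K, h_(K+1), ... the function g_n, n >= K, is a restriction of
    the weakly null g_n + h_n, and these supports shrink to a null set as K
    grows, so that there all the g_n are uniformly small.

    The sequence (g_n) has a subsequence all of whose further subsequences have
    norm null Cesaro means ([uniformly_ac_cesaro]). Up to a uniformly small error the g_n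
    may be truncated at a level M. In L^2 of the Rybakov measure, a
    subsequence with converging inner products has Cauchy Cesaro means, and for
    functions bounded by M small L^2 distance means small norm, because
    indicators of small sets have small norm ([bounded_small_norm]). Thus
    the Cesaro means of (g_n) are Cauchy in norm; being weakly null they
    converge to zero ([weakly_null_cauchy]).

    The sequence (h_n) is transported to X. A single function with values in
    {-1, 0, 1} is a sign for all the disjoint h_n, so the |h_n| are weakly null
    too ([disjoint_abs_weakly_null]), and so are their integrals v_n in X. The
    weak Banach-Saks property of X gives a subsequence of (v_n) with norm null
    Cesaro means. As m is positive, a nonnegative f in L^1(m) has norm at most
    that of its integral ([norm_le_vector_integral]), so the Cesaro means of the
    corresponding |h_n|, a fortiori of the h_n, tend to zero.

    The Hahn-Banach theorem enters twice: through norming functionals, and,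
    applied to the sublinear functional x |-> ||x^+||, to see that an element of
    X on which all positive functionals are nonnegative is itself nonnegative. *)

(** * Hahn-Banach and weakly null sequences *)

Section hahn_banach.
Context {R : realType} {V : lmodType R}.
Implicit Types (p : V -> R) (x y z : V).

Definition sublinear p : Prop :=
  (forall x y, p (x + y) <= p x + p y) /\
  (forall a x, 0 <= a -> p (a *: x) = a * p x).

Lemma sublinear0 p : sublinear p -> p 0 = 0.
Proof. by move=> [_ ph]; have := ph 0 0 (lexx _); rewrite scale0r mul0r. Qed.

Lemma sublinear_geN p x : sublinear p -> - p (- x) <= p x.
Proof.
by move=> sp; have := sp.1 x (- x); rewrite subrr (sublinear0 sp); lra.
Qed.

(** Gives positive homogeneity of the two infima of functionals taken below:
    over the translates in one direction, and over a chain. *)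
Lemma inf_scale (E E' : set R) a : 0 < a -> E !=set0 -> has_lbound E ->
  E' = [set a * e | e in E] -> inf E' = a * inf E.
Proof.
move=> a0 E0 [l lE] ->; apply/eqP; rewrite eq_le; apply/andP; split.
  rewrite -ler_pdivrMl//; apply: lb_le_inf => // e Ee.
  rewrite ler_pdivrMl//; apply: ge_inf; last by exists e.
  by exists (a * l) => _ [f Ef <-]; rewrite ler_pM2l//; exact: lE.
apply: lb_le_inf; first by have [e Ee] := E0; exists (a * e), e.
by move=> _ [f Ef <-]; rewrite ler_pM2l//; apply: ge_inf => //; exists l.
Qed.

(** The largest sublinear functional q below [p] with [q (- y) = - p y]; it is
    strictly smaller than [p] unless [p] is already odd at [y]. *)
Definition directional p y x : R :=
  inf [set p (x + t *: y) - t * p y | t in [set t : R | 0 <= t]].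

Lemma directional_lb p y x : sublinear p ->
  lbound [set p (x + t *: y) - t * p y | t in [set t : R | 0 <= t]] (- p (- x)).
Proof.
move=> sp _ [t /= t0 <-]; rewrite -(sp.2 _ _ t0).
by have := sp.1 (x + t *: y) (- x); rewrite addrAC subrr add0r; lra.
Qed.

Lemma directional_ub p y x t : sublinear p -> 0 <= t ->
  directional p y x <= p (x + t *: y) - t * p y.
Proof.
move=> sp t0; apply: ge_inf; last by exists t.
by exists (- p (- x)); exact: directional_lb.
Qed.

Lemma directional_le p y x : sublinear p -> directional p y x <= p x.
Proof.
by move=> sp; have := directional_ub y x sp (lexx 0); rewrite scale0r addr0 mul0r subr0.
Qed.

Lemma directional_opp p y : sublinear p -> directional p y (- y) <= - p y.
Proof.
move=> sp; have := directional_ub y (- y) sp ler01.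
by rewrite scale1r addNr (sublinear0 sp) mul1r sub0r.
Qed.

Lemma directional_sublinear p y : sublinear p -> sublinear (directional p y).
Proof.
move=> sp; split=> [x z|a x].
  apply/ler_addgt0Pr => e e0.
  have h u : has_inf [set p (u + t *: y) - t * p y | t in [set t : R | 0 <= t]].
    split; first by exists (p (u + 0 *: y) - 0 * p y), 0 => /=.
    by exists (- p (- u)); exact: directional_lb.
  have e2 : 0 < e / 2 by lra.
  have [_ [t /= t0 <-] tlt] := inf_adherent e2 (h x).
  have [_ [s /= s0 <-] slt] := inf_adherent e2 (h z).
  rewrite -!/(directional p y _) in tlt slt.
  have := directional_ub y (x + z) sp (addr_ge0 t0 s0).
  have := sp.1 (x + t *: y) (z + s *: y).
  rewrite addrACA -scalerDl; lra.
rewrite le_eqVlt => /predU1P[<-|a0].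
  rewrite scale0r mul0r; apply/eqP; rewrite eq_le; apply/andP; split.
    by rewrite (le_trans (directional_le _ _ sp))// (sublinear0 sp).
  apply: lb_le_inf; first by exists (p (0 + 0 *: y) - 0 * p y), 0 => /=.
  by move=> _ [t /= t0 <-]; rewrite add0r sp.2// subrr.
apply: inf_scale => //.
- by exists (p (x + 0 *: y) - 0 * p y), 0 => /=.
- by exists (- p (- x)); exact: directional_lb.
apply/seteqP; split => [_ [t /= t0 <-]|_ [_ [t /= t0 <-] <-]].
  exists (p (x + (t / a) *: y) - (t / a) * p y); first by exists (t / a) => //=; rewrite divr_ge0// ltW.
  rewrite mulrBr -sp.2 ?ltW// scalerDr scalerA mulrCA divff ?gt_eqF// mulr1.
  by rewrite mulrA (mulrCA a) divff ?gt_eqF// mulr1.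
exists (a * t); first by rewrite /= mulr_ge0// ltW.
by rewrite -scalerA -scalerDr sp.2 ?ltW//; ring.
Qed.

(** A minimal sublinear functional coincides with all its directional
    modifications, hence is odd; and an odd sublinear functional is linear. *)
Lemma minimal_sublinear_linear p : sublinear p ->
  (forall q, sublinear q -> (forall x, q x <= p x) -> forall x, p x <= q x) ->
  scalar p.
Proof.
move=> sp minp.
have pN y : p (- y) = - p y.
  apply/eqP; rewrite eq_le; apply/andP; split; last first.
    by have := sublinear_geN y sp; lra.
  apply: le_trans (directional_opp y sp).
  by apply: minp; [exact: directional_sublinear|move=> x; exact: directional_le].
have pD x y : p (x + y) = p x + p y.
  have := sp.1 x y; have := sp.1 (x + y) (- y); rewrite addrK pN.
  by move=> h1 h2; apply/eqP; rewrite eq_le h2 /=; lra.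
move=> a x y; rewrite pD; congr (_ + _).
have [a0|a0] := leP 0 a; first exact: sp.2.
have na : 0 <= - a by rewrite oppr_ge0 ltW.
by rewrite -[in LHS](opprK a) scaleNr pN (sp.2 _ _ na) mulNr opprK.
Qed.

(** Zorn's lemma applies to the sublinear functionals below [p]: a chain has a
    pointwise infimum, because every functional of the family is bounded below
    by [- p (- x)] at [x]. *)
Lemma minimal_sublinear p : sublinear p ->
  exists q, [/\ sublinear q, forall x, q x <= p x &
    forall r, sublinear r -> (forall x, r x <= q x) -> forall x, q x <= r x].
Proof.
move=> sp; pose P q := sublinear q /\ forall x, q x <= p x.
pose T := sig P; pose p0 : T := exist P p (conj sp (fun x => lexx (p x))).
pose below : rel T := fun q r => `[< forall x, sval r x <= sval q x >].
have [] := @ZL_preorder T p0 below.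
- by move=> q; apply/asboolP.
- move=> q r s /asboolP qr /asboolP rs; apply/asboolP => x.
  exact: le_trans (rs x) (qr x).
- move=> A Atot; have [->|/set0P[q0 Aq0]] := eqVneq A set0.
    by exists p0.
  pose E x := [set sval q x | q in A].
  have lb x : lbound (E x) (- p (- x)).
    move=> _ [q Aq <-]; have [sq qp] := svalP q.
    by have := sublinear_geN x sq; have := qp (- x); lra.
  have E0 x : E x !=set0 by exists (sval q0 x), q0.
  pose l x := inf (E x).
  have lle q x : A q -> l x <= sval q x.
    by move=> Aq; apply: ge_inf; [exists (- p (- x))|exists q].
  have sl : sublinear l.
    split=> [x y|a x].
      apply/ler_addgt0Pr => e e0; have e2 : 0 < e / 2 by lra.
      have [_ [q Aq <-] qx] := inf_adherent e2 (conj (E0 x) (ex_intro _ _ (lb x))).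
      have [_ [r Ar <-] ry] := inf_adherent e2 (conj (E0 y) (ex_intro _ _ (lb y))).
      rewrite -!/(l _) in qx ry.
      have [s [As sx sy]] : exists s, [/\ A s, sval s x <= sval q x & sval s y <= sval r y].
        by have [/asboolP h|/asboolP h] := Atot _ _ Aq Ar; [exists r|exists q].
      by have := lle _ (x + y) As; have [[sD _] _] := svalP s; have := sD x y; lra.
    rewrite le_eqVlt => /predU1P[<-|a0].
      rewrite scale0r mul0r /l (_ : E 0 = [set 0]) ?inf1//.
      apply/seteqP; split => [_ [q Aq <-]|_ ->].
        by rewrite (sublinear0 (svalP q).1).
      by exists q0 => //; rewrite (sublinear0 (svalP q0).1).
    apply: inf_scale => //; first by exists (- p (- x)).
    apply/seteqP; split => [_ [q Aq <-]|_ [_ [q Aq <-] <-]].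
      exists (sval q x); first by exists q.
      by rewrite (svalP q).1.2 // ltW.
    by exists q => //; rewrite (svalP q).1.2 // ltW.
  have lp x : l x <= p x by apply: le_trans (lle _ _ Aq0) ((svalP q0).2 x).
  exists (exist P l (conj sl lp)) => q Aq; apply/asboolP => x /=; exact: lle.
move=> [q [sq qp]] qmin; exists q; split => // r sr rq x.
have rp y : r y <= p y by exact: le_trans (rq y) (qp y).
have := qmin (exist P r (conj sr rp)).
by move=> /(_ _)/asboolP; apply; apply/asboolP.
Qed.

(** Hahn-Banach. Any linear functional below the modification of [p] along
    [x] is at most [- p x] at [- x], hence attains the value [p x] at [x]. *)
Lemma hahn_banach p x : sublinear p ->
  exists f : V -> R, [/\ scalar f, forall y, f y <= p y & f x = p x].
Proof.
move=> sp; have sd := directional_sublinear x sp.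
have [f [sf fd fmin]] := minimal_sublinear sd.
have lf := minimal_sublinear_linear sf fmin.
have fp y : f y <= p y by exact: le_trans (fd y) (directional_le _ _ sp).
exists f; split => //; apply/eqP; rewrite eq_le fp /=.
have f0 := sublinear0 sf; have := lf (-1) x 0; rewrite f0 !addr0 scaleN1r.
by have := fd (- x); have := directional_opp x sp; lra.
Qed.

End hahn_banach.

Section dual.
Context {R : realType} {Z : normedModType R}.

Lemma bounded_functional (f : Z -> R) (C : R) : scalar f ->
  (forall x, `|f x| <= C * `|x|) -> exists phi : cdual Z, forall x, phi x = f x.
Proof.
move=> lf fC.
pose L : {linear Z -> R} := HB.pack f (GRing.isLinear.Build _ _ _ _ f lf).
have cf : continuous f.
  apply: (@linear_bounded_continuous _ _ _ L).1; apply/linear_boundedP.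
  exists C; split => //; first exact: num_real.
  by move=> r Cr x; rewrite (le_trans (fC x))// ler_wpM2r// ltW.
by exists (Dual (asboolT (conj lf cf))).
Qed.

Lemma dominated_functional (f : Z -> R) : scalar f ->
  (forall x, f x <= `|x|) ->
  exists phi : cdual Z, `|phi| <= 1 /\ forall x, phi x = f x.
Proof.
move=> lf fn.
have fN x : f (- x) = - f x.
  have f0 : f 0 = 0 by have := lf 1 0 0; rewrite scale1r addr0 mul1r; lra.
  by have := lf (-1) x 0; rewrite f0 !addr0 scaleN1r mulN1r.
have fb x : `|f x| <= `|x|.
  by rewrite ler_norml fn andbT; have := fn (- x); rewrite fN normrN; lra.
have [|phi phiE] := @bounded_functional f 1 lf; first by move=> x; rewrite mul1r.
exists phi; split => //; apply: dual_norm_le => x x1; rewrite phiE.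
exact: le_trans (fb x) x1.
Qed.

Lemma norming_functional (x : Z) : exists2 phi : cdual Z, `|phi| <= 1 & phi x = `|x|.
Proof.
have sn : sublinear (fun y : Z => `|y|).
  by split => [y z|a y a0]; [exact: ler_normD|rewrite normrZ ger0_norm].
have [f [lf fn fx]] := hahn_banach x sn.
by have [phi [phi1 phiE]] := dominated_functional lf fn; exists phi => //; rewrite phiE.
Qed.

Lemma separate_points (x y : Z) :
  (forall phi : cdual Z, `|phi| <= 1 -> phi x = phi y) -> x = y.
Proof.
move=> xy; have [phi phi1 phiE] := norming_functional (x - y).
by apply/eqP; rewrite -subr_eq0 -normr_eq0 -phiE linearB /= xy// subrr.
Qed.

Definition cesaro_mean (z : nat -> Z) (n : nat) : Z :=
  n.+1%:R^-1 *: \sum_(k < n.+1) z k.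

Lemma cesaro_meanD (y z : nat -> Z) n :
  cesaro_mean (fun k => y k + z k) n = cesaro_mean y n + cesaro_mean z n.
Proof. by rewrite /cesaro_mean big_split /= scalerDr. Qed.

Lemma cesaro_meanB (y z : nat -> Z) n :
  cesaro_mean (fun k => y k - z k) n = cesaro_mean y n - cesaro_mean z n.
Proof. by rewrite /cesaro_mean sumrB scalerBr. Qed.

Lemma cesaro_mean_norm (z : nat -> Z) (e : R) n : (forall k, `|z k| <= e) ->
  `|cesaro_mean z n| <= e.
Proof.
move=> ze; rewrite /cesaro_mean normrZ ger0_norm// ler_pdivrMl ?ltr0n//.
rewrite (le_trans (ler_norm_sum _ _ _))// (@le_trans _ _ (\sum_(k < n.+1) e))//.
  by apply: ler_sum => k _; exact: ze.
by rewrite sumr_const card_ord mulr_natl.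
Qed.

Lemma cvg_sub (T : topologicalType) (u : nat -> T) (l : T) (s : nat -> nat) :
  {homo s : i j / (i < j)%N} -> u @ \oo --> l -> (u \o s) @ \oo --> l.
Proof.
move=> hs ul; apply: cvg_comp ul.
move=> A [N _ NA]; exists N => // n /= Nn; apply: NA => /=.
by apply: leq_trans Nn _; elim: n => // n IHn; rewrite (leq_ltn_trans IHn)// hs.
Qed.

Lemma weakly_null_sub (z : nat -> Z) (s : nat -> nat) :
  {homo s : i j / (i < j)%N} -> weakly_null z -> weakly_null (z \o s).
Proof. by move=> hs wz phi; exact: (cvg_sub hs (wz phi)). Qed.

Lemma weakly_nullB (y z : nat -> Z) : weakly_null y -> weakly_null z ->
  weakly_null (fun n => y n - z n).
Proof.
move=> wy wz phi; rewrite (_ : (fun n => _) = (fun n => phi (y n) - phi (z n))).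
  by have h := cvgB (wy phi) (wz phi); rewrite subr0 in h; exact: h.
by apply/funext => n; rewrite linearB.
Qed.

(** Evaluation at the [z n] is a pointwise bounded family on the Banach space
    dual to [Z], and norming functionals recover [`|z n|] from it. *)
Lemma weakly_null_bounded (z : nat -> Z) : weakly_null z ->
  exists M : R, forall n, `|z n| <= M.
Proof.
move=> wz; pose F := [set (fun phi : cdual Z => phi (z n) : R) | n in setT].
have FP : forall T : cdual Z -> R, F T -> bounded_fun_norm T /\ linear T.
  move=> _ [n _ <-]; split => // r.
  exists (r * `|z n|) => phi phir; rewrite (le_trans (dual_le _ _))//.
  by rewrite ler_wpM2r.
have Fpt : pointwise_bounded F.
  move=> phi; have /cvg_seq_bounded/pinfty_ex_gt0[M M0 hM] : cvgn (fun n => phi (z n)).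
    by apply/cvg_ex; exists 0; exact: wz.
  by exists M => _ [n _ <-]; exact: (hM n).
have [M hM] := Banach_Steinhauss FP Fpt 1.
exists M => n; have [phi phi1 phin] := norming_functional (z n).
have := hM _ (ex_intro2 _ _ n I erefl) phi phi1.
by rewrite phin normr_id.
Qed.

Lemma weakly_null_cesaro (z : nat -> Z) : weakly_null z ->
  weakly_null (cesaro_mean z).
Proof.
move=> wz phi; rewrite (_ : (fun n => _) = arithmetic_mean (fun n => phi (z n))).
  exact: cesaro (wz phi).
apply/funext => n; rewrite /cesaro_mean linearZ /= linear_sum /=.
by rewrite /arithmetic_mean /series /= big_mkord.
Qed.

(** A functional norming [z n] sees [z n] as close to the values at [z k],
    which tend to zero. *)
Lemma weakly_null_cauchy (z : nat -> Z) : weakly_null z ->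
  (forall e : R, 0 < e -> exists N, forall n k,
     (N <= n)%N -> (N <= k)%N -> `|z n - z k| <= e) ->
  z @ \oo --> (0 : Z).
Proof.
move=> wz cz; apply/cvgrPdist_le => e e0.
have e2 : 0 < e / 2 by lra.
have [N hN] := cz _ e2; exists N => // n /= Nn.
have [phi phi1 phin] := norming_functional (z n).
have /cvgrPdist_le/(_ _ e2)[K _ hK] := wz phi.
have := hK (maxn N K) (leq_maxr _ _); rewrite sub0r normrN => phik.
have := hN n (maxn N K) Nn (leq_maxl _ _); set k := maxn N K in phik * => nk.
rewrite sub0r normrN -phin (_ : phi (z n) = phi (z n - z k) + phi (z k)); last first.
  by rewrite linearB /= subrK.
have := dual_le phi (z n - z k).
have : `|phi| * `|z n - z k| <= `|z n - z k| by rewrite ler_piMl.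
by have := ler_norm (phi (z n - z k)); have := ler_norm (phi (z k)); lra.
Qed.

End dual.

Lemma weakly_null_operator {R : realType} (Y Z : normedModType R) (T : Y -> Z)
    (C : R) (y : nat -> Y) :
  linear T -> (forall x, `|T x| <= C * `|x|) -> weakly_null y ->
  weakly_null (T \o y).
Proof.
move=> lT TC wy phi.
have [|x|psi psiE] := @bounded_functional _ _ (fun x => phi (T x)) (`|phi| * C).
- by move=> a u v; rewrite lT linearP.
- by rewrite (le_trans (dual_le _ _))// -mulrA ler_wpM2l.
- rewrite (_ : (fun n => _) = (fun n => psi (y n))); first exact: wy.
  by apply/funext => n; rewrite psiE.
Qed.

(** * Subsequences with converging double limits *)

Section ultrafilter_selection.
Context {R : realType}.

Lemma ultra_bounded_cvg (U : set_system nat) (u : nat -> R) (C : R) :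
  UltraFilter U -> (forall n, `|u n| <= C) ->
  exists l : R, forall e : R, 0 < e -> U [set n | `|u n - l| <= e].
Proof.
move=> UU uC; have FU : ProperFilter (u @ U) by exact: fmap_proper_filter.
have [|l [_ lU]] := @segment_compact R (- C) C (u @ U) FU.
  by apply: (@filterE _ U) => n /=; rewrite in_itv/= -ler_norml; exact: uC.
exists l => e e0; have [//|Uc] := in_ultra_setVsetC [set n | `|u n - l| <= e] UU.
have lb : nbhs l (ball l e) by exact: nbhsx_ballx.
have [|r [/= [n nr <-]]] := lU (u @` (~` [set n | `|u n - l| <= e])) (ball l e) _ lb.
  by apply: (@filterS _ U _ _ _ _ Uc) => n /= hn; exists n.
by rewrite -ball_normE /ball_/= => /ltW; rewrite distrC.
Qed.

(** Along a free ultrafilter all the limits of [B M i j], first in [j] and then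
    in [i], exist at once. A subsequence realizing them up to errors [1 / i] is
    then picked greedily: each requirement on the next index holds on a set of
    the ultrafilter, and at each step there are finitely many of them. *)
Lemma double_limit_subsequence (B : nat -> nat -> nat -> R) (C : nat -> R) :
  (forall M i j, `|B M i j| <= C M) ->
  exists (s : nat -> nat) (c : nat -> R), {homo s : i j / (i < j)%N} /\
    forall M i j, (M <= i)%N -> (i < j)%N ->
      `|B M (s i) (s j) - c M| <= 2 / i.+1%:R.
Proof.
move=> BC; have [U [UU ooU]] := ultraFilterLemma (@eventually_filter).
have [b bU] : exists b : nat -> nat -> R, forall M i (e : R), 0 < e ->
    U [set j | `|B M i j - b M i| <= e].
  have h M i := cid (ultra_bounded_cvg UU (BC M i)).
  by exists (fun M i => sval (h M i)) => M i; exact: svalP (h M i).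
have bC M i : `|b M i| <= C M + 1.
  have [j] := filter_ex (bU M i 1 ltr01); have := BC M i j => /=.
  by rewrite !ler_norml => /andP[? ?] /andP[? ?]; apply/andP; split; lra.
have [c cU] : exists c : nat -> R, forall M (e : R), 0 < e ->
    U [set i | `|b M i - c M| <= e].
  have h M := cid (ultra_bounded_cvg UU (bC M)).
  by exists (fun M => sval (h M)) => M; exact: svalP (h M).
(* Controlling all indices [i <= n], not just those picked before [n], lets the
   next index depend on [n] alone. *)
pose good n j := [/\ (n < j)%N,
  forall M i, (M <= i)%N -> (i <= n)%N -> `|B M i j - b M i| <= i.+1%:R^-1 &
  forall M, (M <= n)%N -> `|b M j - c M| <= n.+1%:R^-1].
have [next nextP] : exists next : nat -> nat, forall n, good n (next n).
  have h n : exists j, good n j.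
    have U1 : U [set j | (n < j)%N] by apply: ooU; exists n.+1.
    have U2 : U [set j | forall p : 'I_n.+1 * 'I_n.+1,
        `|B p.1 p.2 j - b p.1 p.2| <= p.2.+1%:R^-1].
      by apply: filter_forall => p; apply: bU; rewrite invr_gt0.
    have U3 : U [set j | forall M : 'I_n.+1, `|b M j - c M| <= n.+1%:R^-1].
      by apply: filter_forall => M; apply: cU; rewrite invr_gt0.
    have [j [[nj h2] h3]] := filter_ex (filterI (filterI U1 U2) U3).
    exists j; split => // [M i Mi iN|M Mn].
      have Mn : (M < n.+1)%N by rewrite ltnS (leq_trans Mi).
      by have /= := h2 (Ordinal Mn, Ordinal (iN : (i < n.+1)%N)).
    exact: h3 (Ordinal (Mn : (M < n.+1)%N)).
  by exists (fun n => sval (cid (h n))) => n; exact: svalP (cid (h n)).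
pose a k := iter k next 0%N.
have ha : {homo a : i j / (i < j)%N}.
  by apply: homo_ltn => // [i j k|i]; [exact: ltn_trans|have [] := nextP (a i)].
have ak k : (k <= a k)%N.
  by elim: k => // k IHk; rewrite (leq_ltn_trans IHk)//; exact: ha.
(* The shift skips [a 0 = 0], which has not been chosen as good. *)
exists (fun k => a k.+1), c; split => [i j ij|M i j Mi ij]; first exact: ha.
have [_ h2 _] := nextP (a j); have [_ _ h3] := nextP (a i).
have h2' : `|B M (a i.+1) (a j.+1) - b M (a i.+1)| <= i.+1%:R^-1.
  apply: (le_trans (h2 M (a i.+1) _ _)).
  - exact: leq_trans Mi (leq_trans (leqnSn i) (ak i.+1)).
  - by have [->//|ij'] := eqVneq i.+1 j; rewrite ltnW// ha// ltn_neqAle ij'.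
  - by rewrite lef_pV2 ?posrE ?ltr0n// ler_nat ltnW// ltnS ak.
have h3' : `|b M (a i.+1) - c M| <= i.+1%:R^-1.
  apply: (le_trans (h3 M (leq_trans Mi (ak i)))).
  by rewrite lef_pV2 ?posrE ?ltr0n// ler_nat ltnS ak.
have := ler_normD (B M (a i.+1) (a j.+1) - b M (a i.+1)) (b M (a i.+1) - c M).
by rewrite addrA subrK; move: h2' h3'; set x := i.+1%:R^-1; lra.
Qed.

End ultrafilter_selection.

Section double_means.
Context {R : realType}.
Implicit Types (B : nat -> nat -> R) (e : nat -> R).

Definition double_mean B (n k : nat) : R :=
  n.+1%:R^-1 * (k.+1%:R^-1 * \sum_(i < n.+1) \sum_(j < k.+1) B i j).

Lemma double_meanB_cst B (c : R) n k :
  double_mean (fun i j => B i j - c) n k = double_mean B n k - c.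
Proof.
rewrite /double_mean; under eq_bigr do rewrite sumrB.
rewrite sumrB !sumr_const !card_ord.
have n0 : n.+1%:R != 0 :> R by rewrite pnatr_eq0.
have k0 : k.+1%:R != 0 :> R by rewrite pnatr_eq0.
rewrite -[c *+ _]mulr_natr -[(c * _) *+ _]mulr_natr.
by move: n.+1%:R k.+1%:R n0 k0 => x y x0 y0; field; rewrite x0 y0.
Qed.

(** [|B i j - c| <= e i + e j] averages to a sum of two Cesaro means of [e];
    the diagonal, where it may fail, has a vanishing share of the entries. *)
Lemma double_mean_cvg B e (c K : R) :
  (forall i, 0 <= e i) -> e @ \oo --> (0 : R) ->
  (forall i, `|B i i| <= K) -> (forall i j, i != j -> `|B i j - c| <= e i + e j) ->
  forall eps, 0 < eps -> exists N, forall n k, (N <= n)%N -> (N <= k)%N ->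
    `|double_mean B n k - c| <= eps.
Proof.
move=> e0 ecv BK Be eps eps0.
have [D DE] : exists D, D = K + `|c| by exists (K + `|c|).
have K0 : 0 <= K := le_trans (normr_ge0 _) (BK 0%N).
have D0 : 0 <= D by rewrite DE addr_ge0.
pose em n := n.+1%:R^-1 * \sum_(i < n.+1) e i.
have le_em n k : `|double_mean B n k - c| <= em n + em k + k.+1%:R^-1 * D.
  rewrite -double_meanB_cst /double_mean normrM ger0_norm ?invr_ge0//.
  rewrite normrM (@ger0_norm _ k.+1%:R^-1) ?invr_ge0//.
  have BD i j : `|B i j - c| <= e i + e j + D * (i == j)%:R.
    have [<-|ij] := eqVneq i j; last by rewrite mulr0 addr0 Be.
    rewrite mulr1 DE (le_trans (ler_normB _ _))//.
    by rewrite ler_wpDl ?addr_ge0// lerD.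
  have row i : \sum_(j < k.+1) `|B i j - c| <=
      e i *+ k.+1 + \sum_(j < k.+1) e j + D.
    apply: (@le_trans _ _ (\sum_(j < k.+1) (e i + e j + D * (i == j :> nat)%:R))).
      by apply: ler_sum => j _; exact: BD.
    rewrite !big_split /= sumr_const card_ord lerD2l -mulr_sumr ler_piMr//.
    (* Row [i] meets the diagonal at most once. *)
    have [ik|ki] := ltnP i k.+1.
      rewrite (bigD1 (Ordinal ik))//= eqxx big1 ?addr0// => j /eqP ij.
      by case: eqP => // ij'; case: ij; exact/val_inj.
    rewrite big1 // => j _; case: eqP => // ij.
    by move: (ltn_ord j); rewrite -ij ltnNge ki.
  rewrite /em !ler_pdivrMl ?ltr0n//.
  have nk0 : n.+1%:R != 0 :> R by rewrite pnatr_eq0.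
  have k0 : k.+1%:R != 0 :> R by rewrite pnatr_eq0.
  apply: (@le_trans _ _ (\sum_(i < n.+1) (e i *+ k.+1 + \sum_(j < k.+1) e j + D))).
    rewrite (le_trans (ler_norm_sum _ _ _))// ler_sum// => i _.
    by rewrite (le_trans (ler_norm_sum _ _ _))// row.
  rewrite !big_split /= !sumr_const !card_ord sumrMnl.
  rewrite -(mulr_natr D) -(mulr_natr (\sum_(i < n.+1) e i)).
  rewrite -(mulr_natr (\sum_(i < k.+1) e i)) le_eqVlt; apply/orP; left; apply/eqP.
  by move: n.+1%:R k.+1%:R nk0 k0 => x y x0 y0; field; rewrite ?x0 ?y0.
have emcv : em @ \oo --> (0 : R).
  rewrite (_ : em = arithmetic_mean e); first exact: cesaro.
  by apply/funext => n; rewrite /arithmetic_mean /series /= big_mkord.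
have Dcv : (fun k => k.+1%:R^-1 * D) @ \oo --> (0 : R).
  by rewrite -[X in _ --> X](mul0r D); apply: cvgMr_tmp; exact: cvg_harmonic.
have eps3 : 0 < eps / 3 by lra.
have /cvgrPdist_le/(_ _ eps3)[N1 _ h1] := emcv.
have /cvgrPdist_le/(_ _ eps3)[N2 _ h2] := Dcv.
exists (maxn N1 N2) => n k; rewrite !geq_max => /andP[n1 n2] /andP[k1 k2].
have := h1 n n1; have := h1 k k1; have := h2 k k2; rewrite /= !sub0r !normrN.
have := le_em n k; have := ler_norm (em n); have := ler_norm (em k).
have := ler_norm (k.+1%:R^-1 * D); move: (k.+1%:R^-1 * D) => d; lra.
Qed.

End double_means.

(** * Means of bounded functions in L^2 *)

Section measure_preliminaries.
Context {R : realType} d (T : measurableType d) (mu : {measure set T -> \bar R}).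

Lemma measurable_gt (f : T -> R) (a : R) : measurable_fun setT f ->
  measurable [set w | a < f w].
Proof.
move=> mf; rewrite (_ : [set w | _] = f @^-1` `]a, +oo[); last first.
  by apply/seteqP; split => w /=; rewrite in_itv/= andbT.
by rewrite -[X in measurable X]setTI; exact: mf.
Qed.

Lemma markov_gt (f : T -> R) (a : R) : measurable_fun setT f ->
  (forall w, 0 <= f w) -> 0 <= a ->
  (a%:E * mu [set w | (a < f w)%R] <= \int[mu]_w (f w)%:E)%E.
Proof.
move=> mf f0 a0; have mA := measurable_gt a mf.
rewrite -integral_cst//; apply: (@le_trans _ _ (\int[mu]_(w in [set w | (a < f w)%R]) (f w)%:E)%E).
  apply: ge0_le_integral => //=.
  - by apply/measurable_EFinP; exact: (measurable_funTS mf).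
  - by move=> w /= aw; rewrite lee_fin ltW.
apply: ge0_subset_integral => //=; first exact/measurable_EFinP.
by move=> w _; rewrite lee_fin.
Qed.

Hypothesis mu_fin : (mu setT < +oo)%E.

Lemma bounded_integrable (f : T -> R) (K : R) : measurable_fun setT f ->
  (forall w, `|f w| <= K) -> mu.-integrable setT (EFin \o f).
Proof.
move=> mf fK; apply: measurable_bounded_integrable => //.
by exists K; split => [|x Kx w _]; [exact: num_real|exact: le_trans (fK w) (ltW Kx)].
Qed.

Lemma Rintegral_sum (I : Type) (s : seq I) (f : I -> T -> R) :
  (forall i, mu.-integrable setT (EFin \o f i)) ->
  \int[mu]_w (\sum_(i <- s) f i w) = \sum_(i <- s) \int[mu]_w f i w.
Proof.
move=> fi; have int_sum r : mu.-integrable setT (EFin \o (fun w => \sum_(i <- r) f i w)).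
  elim: r => [|i r IHr].
    by under eq_fun do rewrite /= big_nil; exact: integrable0.
  under eq_fun do rewrite /= big_cons.
  exact: (integrableD measurableT (fi i) IHr).
elim: s => [|i s IHs].
  under eq_Rintegral do rewrite big_nil.
  by rewrite Rintegral_cst// mul0r big_nil.
under eq_Rintegral do rewrite big_cons.
by rewrite RintegralD// IHs big_cons.
Qed.

Variables (u : nat -> T -> R) (K : R).
Hypothesis u_meas : forall i, measurable_fun setT (u i).
Hypothesis uK : forall i w, `|u i w| <= K.

Definition pointwise_mean n w : R := n.+1%:R^-1 * \sum_(k < n.+1) u k w.

Lemma pointwise_mean_bounded n w : `|pointwise_mean n w| <= K.
Proof.
rewrite /pointwise_mean normrM ger0_norm// ler_pdivrMl ?ltr0n//.
rewrite (le_trans (ler_norm_sum _ _ _))// (@le_trans _ _ (\sum_(k < n.+1) K))//.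
  by apply: ler_sum => k _; exact: uK.
by rewrite sumr_const card_ord mulr_natl.
Qed.

Lemma measurable_pointwise_mean n : measurable_fun setT (pointwise_mean n).
Proof.
by apply: measurable_funM; [exact: measurable_cst|apply: measurable_sum => i].
Qed.

Let bound_mul (a b : R) : `|a| <= K -> `|b| <= K -> `|a * b| <= K * K.
Proof. by move=> aK bK; rewrite normrM ler_pM. Qed.

Lemma Rintegral_mean_mul n k :
  \int[mu]_w (pointwise_mean n w * pointwise_mean k w) =
  double_mean (fun i j => \int[mu]_w (u i w * u j w)) n k.
Proof.
have intu i j : mu.-integrable setT (EFin \o (fun w => u i w * u j w)).
  apply: (@bounded_integrable _ (K * K)); first exact: measurable_funM.
  by move=> w; apply: bound_mul.
have ints (i : nat) : mu.-integrable setT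
    (EFin \o (fun w => \sum_(j < k.+1) u i w * u j w)).
  apply: (@bounded_integrable _ (K * K *+ k.+1)).
    by apply: measurable_sum => j; exact: measurable_funM.
  move=> w; rewrite (le_trans (ler_norm_sum _ _ _))//.
  rewrite (@le_trans _ _ (\sum_(j < k.+1) K * K))//.
    by apply: ler_sum => j _; exact: bound_mul.
  by rewrite sumr_const card_ord.
have intss : mu.-integrable setT
    (EFin \o (fun w => \sum_(i < n.+1) \sum_(j < k.+1) u i w * u j w)).
  apply: (@bounded_integrable _ (K * K *+ k.+1 *+ n.+1)).
    by apply: measurable_sum => i; apply: measurable_sum => j; exact: measurable_funM.
  move=> w; rewrite (le_trans (ler_norm_sum _ _ _))//.
  rewrite (@le_trans _ _ (\sum_(i < n.+1) (K * K *+ k.+1)))//; last first.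
    by rewrite sumr_const card_ord.
  apply: ler_sum => i _; rewrite (le_trans (ler_norm_sum _ _ _))//.
  rewrite (@le_trans _ _ (\sum_(j < k.+1) K * K))//.
    by apply: ler_sum => j _; exact: bound_mul.
  by rewrite sumr_const card_ord.
rewrite /double_mean mulrA.
under [in RHS]eq_bigr do rewrite -Rintegral_sum//.
rewrite -Rintegral_sum// -RintegralZl//.
apply: eq_Rintegral => w _; rewrite /pointwise_mean mulrACA; congr (_ * _).
by rewrite mulr_suml; apply: eq_bigr => i _; rewrite mulr_sumr.
Qed.

(** Cauchy sequences of means in L^2 are read off the double means of the inner
    products. *)
Lemma Rintegral_mean_sqr n k (B := fun i j => \int[mu]_w (u i w * u j w)) :
  \int[mu]_w (pointwise_mean n w - pointwise_mean k w) ^+ 2 =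
  double_mean B n n - 2 * double_mean B n k + double_mean B k k.
Proof.
have int i j : mu.-integrable setT
    (EFin \o (fun w => pointwise_mean i w * pointwise_mean j w)).
  apply: (@bounded_integrable _ (K * K)).
    by apply: measurable_funM; exact: measurable_pointwise_mean.
  by move=> w; apply: bound_mul; exact: pointwise_mean_bounded.
have int2 := integrableZl measurableT 2 (int n k).
have intB := integrableB measurableT (int n n) int2.
rewrite -!Rintegral_mean_mul -(RintegralZl 2 measurableT (int n k)).
rewrite -(RintegralB measurableT (int n n) int2).
rewrite -(RintegralD measurableT intB (int k k)).
by apply: eq_Rintegral => w _; ring.
Qed.

End measure_preliminaries.

(** * Function spaces between L^oo and L^1 *)

Section function_space_theory.
Context {R : realType} d (S : measurableType d) (eta : {measure set S -> \bar R}).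
Context (Z : normedModType R) (F : function_space eta Z).
Implicit Types (x y z : Z) (A B : set S).

Lemma ae_and (P Q : S -> Prop) : {ae eta, forall s, P s} ->
  {ae eta, forall s, Q s} -> {ae eta, forall s, P s /\ Q s}.
Proof. exact: filterS2. Qed.

Lemma fs_linearE (a : R) y z :
  {ae eta, forall s, F (a *: y + z) s = a * F y s + F z s}.
Proof. exact: fs_linear. Qed.

Lemma fs0 : {ae eta, forall s, F 0 s = 0}.
Proof.
have := fs_linearE (-1) 0 0; rewrite scaler0 addr0.
by apply: filterS => s ->; rewrite mulN1r addNr.
Qed.

Lemma fsD y z : {ae eta, forall s, F (y + z) s = F y s + F z s}.
Proof. by have := fs_linearE 1 y z; rewrite scale1r; apply: filterS => s ->; rewrite mul1r. Qed.

Lemma fsB y z : {ae eta, forall s, F (y - z) s = F y s - F z s}.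
Proof.
have := fs_linearE (-1) z y; rewrite scaleN1r addrC.
by apply: filterS => s ->; rewrite mulN1r addrC.
Qed.

Lemma fsZ (a : R) z : {ae eta, forall s, F (a *: z) s = a * F z s}.
Proof.
have := fs_linearE a z 0; rewrite addr0.
by apply: filterS2 fs0 => s -> ->; rewrite addr0.
Qed.

Lemma fsN z : {ae eta, forall s, F (- z) s = - F z s}.
Proof. by have := fsZ (-1) z; rewrite scaleN1r; apply: filterS => s ->; rewrite mulN1r. Qed.

Lemma fs_eq y z : {ae eta, forall s, F y s = F z s} -> y = z.
Proof.
move=> yz; apply/eqP; rewrite -subr_eq0; apply/eqP; apply: (fs_inj (f := F)).
by apply: filterS2 yz (fsB y z) => s yz ->; rewrite yz subrr.
Qed.

Lemma fs_sum (z : nat -> Z) n :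
  {ae eta, forall s, F (\sum_(k < n) z k) s = \sum_(k < n) F (z k) s}.
Proof.
elim: n => [|n IHn].
  by apply: filterS fs0 => s; rewrite !big_ord0.
apply: filterS2 IHn (fsD (\sum_(k < n) z k) (z n)) => s IHs.
by rewrite !big_ord_recr /= IHs.
Qed.

Lemma fs_cesaro (z : nat -> Z) n : {ae eta, forall s,
  F (cesaro_mean z n) s = pointwise_mean (fun k => F (z k)) n s}.
Proof.
apply: filterS2 (fs_sum z n.+1) (fsZ n.+1%:R^-1 (\sum_(k < n.+1) z k)) => s h.
by rewrite /cesaro_mean => ->; rewrite h.
Qed.

End function_space_theory.

(** What the arguments on sequences use of L^1(m), apart from absolute
    continuity of its norm. Only restrictions to measurable sets are required to
    stay in the space, not all functions dominated by an element: in L^1(m) the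
    latter would rest on the completeness of X. *)
Record intermediate_space {R : realType} d (S : measurableType d)
    (eta : {measure set S -> \bar R}) (Z : normedModType R)
    (F : function_space eta Z) : Prop := IntermediateSpace {
  is_finite : (eta setT < +oo)%E;
  is_monotone : forall y z : Z,
    {ae eta, forall s, `|F y s| <= `|F z s|} -> `|y| <= `|z|;
  is_restrict : forall (z : Z) A, measurable A ->
    {ae eta, forall s, F (fs_restrict F z A) s = (F z \_ A) s};
  is_unit : exists u, {ae eta, forall s, F u s = 1};
  is_L1 : exists2 C : R, 0 <= C &
    forall z, (\int[eta]_s `|F z s|%:E <= (C * `|z|)%:E)%E
}.

Section intermediate_space_theory.
Context {R : realType} d (S : measurableType d) (eta : {measure set S -> \bar R}).
Context (Z : normedModType R) (F : function_space eta Z).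
Hypothesis HF : intermediate_space F.
Implicit Types (x y z : Z) (A B : set S).

Local Notation "z |^ A" := (fs_restrict F z A) (at level 10).

Lemma restrict_linear A : measurable A -> linear (fun z => z |^ A).
Proof.
move=> mA a y z; apply: (fs_eq (F := F)).
have h1 := ae_and (is_restrict HF (a *: y + z) mA) (fs_linearE F a y z).
have h2 := ae_and (is_restrict HF y mA) (is_restrict HF z mA).
apply: filterS (ae_and (ae_and h1 h2) (fs_linearE F a (y |^ A) (z |^ A))).
move=> s [[[-> h] [yA zA]] ->].
by rewrite yA zA !patchE; case: ifP => // _; rewrite mulr0 addr0.
Qed.

Lemma restrict_contract A : measurable A -> forall z, `|z |^ A| <= 1 * `|z|.
Proof.
move=> mA z; rewrite mul1r; apply: (is_monotone HF).
apply: filterS (is_restrict HF z mA) => s ->.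
by rewrite patchE; case: ifP => // _; rewrite normr0.
Qed.

Lemma restrictC A z : measurable A -> z |^ A + z |^ (~` A) = z.
Proof.
move=> mA; apply: (fs_eq (F := F)).
have zA := ae_and (is_restrict HF z mA) (is_restrict HF z (measurableC mA)).
apply: filterS2 zA (fsD F (z |^ A) (z |^ (~` A))) => s [h1 h2] ->.
rewrite h1 h2 !patchE in_setC; case: ifP => // _; rewrite ?addr0 ?add0r//.
Qed.

Lemma markov_tail (f : S -> R) (a : R) (K : R) : measurable_fun setT f ->
  (forall s, 0 <= f s) -> 0 < a -> (\int[eta]_s (f s)%:E <= K%:E)%E ->
  (eta [set s | (a < f s)%R] <= (K / a)%:E)%E.
Proof.
move=> mf f0 a0 fK; have := markov_gt eta mf f0 (ltW a0).
move=> /le_trans /(_ fK); rewrite muleC -lee_pdivlMr//.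
Qed.

Lemma measurable_large z (a : R) : measurable [set s | a < `|F z s|].
Proof.
by apply: measurable_gt; apply: measurableT_comp => //; exact: (fs_measurable F).
Qed.

(** Bounded elements that are small in L^2 are small outside a set of small
    measure, where absolute continuity of the norm of the unit takes over. *)
Lemma bounded_small_norm (K e : R) : ac_norm F -> 0 <= K -> 0 < e ->
  exists2 delta : R, 0 < delta & forall z,
    {ae eta, forall s, `|F z s| <= K} ->
    (\int[eta]_s ((F z s) ^+ 2)%:E <= delta%:E)%E -> `|z| <= e.
Proof.
move=> acF K0 e0; have [u uE] := is_unit HF.
pose a := e / 2 / (`|u| + 1).
have u0 : 0 < `|u| + 1 by rewrite ltr_pwDr.
have a0 : 0 < a by rewrite !divr_gt0.
have [|t t0 ut] := acF u (e / 2 / (K + 1)); first by rewrite !divr_gt0// ltr_pwDr.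
exists (t / 2 * a ^+ 2); first by rewrite mulr_gt0 ?exprn_gt0// divr_gt0.
move=> z zK z2; pose A := [set s | a < `|F z s|].
have mA : measurable A by exact: measurable_large.
have At : (eta A < t%:E)%E.
  have mz2 : measurable_fun setT (fun s => F z s ^+ 2).
    by apply: measurable_funX; exact: (fs_measurable F).
  have := markov_tail mz2 (fun s => sqr_ge0 _) (exprn_gt0 2 a0) z2.
  rewrite mulfK ?gt_eqF ?exprn_gt0//.
  rewrite (_ : [set s | (a ^+ 2 < F z s ^+ 2)%R] = A); last first.
    apply/seteqP; split => s /=; rewrite -[F z s ^+ 2]real_normK ?num_real//.
      by rewrite ltr_pXn2r// nnegrE// ltW.
    by rewrite /A/= => ?; rewrite ltr_pXn2r// nnegrE// ltW.
  by move=> /le_lt_trans; apply; rewrite lte_fin; lra.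
have h1 : `|z |^ A| <= e / 2.
  apply: (@le_trans _ _ `|K *: (u |^ A)|).
    apply: (is_monotone HF).
    have h := ae_and (is_restrict HF z mA) (is_restrict HF u mA).
    apply: filterS2 (ae_and h (ae_and zK uE)) (fsZ F K (u |^ A)).
    move=> s [[-> uA] [zs us]] ->.
    rewrite uA !patchE; case: ifP => _; last by rewrite mulr0.
    by rewrite us mulr1 (ger0_norm K0).
  rewrite normrZ (ger0_norm K0) (@le_trans _ _ (K * (e / 2 / (K + 1))))//.
    by rewrite ler_wpM2l// ut.
  rewrite mulrA ler_pdivrMr ?ltr_pwDr// mulrC ler_wpM2l ?lerDl//.
  by rewrite divr_ge0// ltW.
have h2 : `|z |^ (~` A)| <= e / 2.
  apply: (@le_trans _ _ `|a *: u|).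
    apply: (is_monotone HF).
    have h := is_restrict HF z (measurableC mA).
    apply: filterS2 (ae_and h uE) (fsZ F a u) => s [-> us] ->.
    rewrite us mulr1 (gtr0_norm a0) patchE; case: ifPn => [|_]; last first.
      by rewrite normr0 ltW.
    by rewrite in_setC => /negP; rewrite inE /A/= => /negP; rewrite -leNgt.
  rewrite normrZ (gtr0_norm a0) /a mulrAC ler_pdivrMr// ler_wpM2l ?lerDl//.
  by rewrite divr_ge0// ltW.
rewrite -(restrictC z mA) (le_trans (ler_normD _ _))//; lra.
Qed.

End intermediate_space_theory.

(** * Splitting a weakly null sequence *)

Section sequences_in_intermediate_space.
Context {R : realType} d (S : measurableType d) (eta : {measure set S -> \bar R}).
Context (Z : normedModType R) (F : function_space eta Z).
Hypothesis HF : intermediate_space F.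
Implicit Types (x y z : Z) (A B : set S).

Local Notation "z |^ A" := (fs_restrict F z A) (at level 10).

Lemma uniformly_ac_tail (g : nat -> Z) (K e : R) :
  uniformly_ac_norm F (range g) -> (forall n, `|g n| <= K) -> 0 < e ->
  exists M : nat, forall n, `|g n |^ [set s | M%:R < `|F (g n) s|]| <= e.
Proof.
move=> ug gK e0; have [C C0 hC] := is_L1 HF.
have [t t0 ht] := ug _ e0.
have K0 : 0 <= K by rewrite (le_trans _ (gK 0%N)).
pose M := (Num.truncn (C * K / t)).+1; exists M => n.
have tM : C * K / M%:R < t.
  by rewrite ltr_pdivrMr ?ltr0n// [ltRHS]mulrC -ltr_pdivrMr//; exact: truncnS_gt.
apply: ht; [exact: measurable_large| |by exists n].
apply: (@le_lt_trans _ _ (C * K / M%:R)%:E); last by rewrite lte_fin.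
have mg : measurable_fun setT (fun s => `|F (g n) s|).
  by apply: measurableT_comp => //; exact: (fs_measurable F).
apply: (markov_tail mg) => //.
by rewrite (le_trans (hC _))// lee_fin ler_wpM2l.
Qed.

(** The Banach-Saks argument of Hilbert space, run in L^2 for all truncation
    levels at once: along the subsequence of [double_limit_subsequence] the
    means of the truncations are Cauchy in L^2, hence in norm, and a weakly null
    Cauchy sequence tends to zero. The estimate on inner products passes to
    further subsequences, so the conclusion holds for all of them; this leaves
    room for a second extraction, dictated by the disjoint part. *)
Lemma uniformly_ac_cesaro (g : nat -> Z) : ac_norm F -> weakly_null g ->
  uniformly_ac_norm F (range g) ->
  exists2 s : nat -> nat, {homo s : i j / (i < j)%N} &
    forall r : nat -> nat, {homo r : i j / (i < j)%N} ->
      cesaro_mean (g \o s \o r) @ \oo --> (0 : Z).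
Proof.
move=> acF wg ug; have [G gG] := weakly_null_bounded wg.
have eta_fin := is_finite HF.
pose A (M i : nat) := [set s | M%:R < `|F (g i) s|].
have mA M i : measurable (A M i) by exact: measurable_large.
pose u (M i : nat) := F (g i) \_ (~` A M i).
have meas_u M i : measurable_fun setT (u M i).
  exact: (measurable_restrictT _ (measurableC (mA M i))).1
    (measurable_funTS (fs_measurable F (g i))).
have uM M i s : `|u M i s| <= M%:R.
  rewrite /u patchE; case: ifPn; last by rewrite normr0.
  by rewrite in_setC => /negP; rewrite inE /A/= => /negP; rewrite -leNgt.
pose B M i j := \int[eta]_w (u M i w * u M j w).
have BC M i j : `|B M i j| <= M%:R ^+ 2 * fine (eta setT).
  have muu : measurable_fun setT (fun w => u M i w * u M j w) by exact: measurable_funM.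
  have uub w : `|u M i w * u M j w| <= M%:R ^+ 2 by rewrite normrM expr2 ler_pM.
  have iuu := bounded_integrable eta_fin muu uub.
  rewrite (le_trans (le_normr_Rintegral _ iuu))// -Rintegral_cst//.
  apply: le_Rintegral => //; first exact: (integrable_norm iuu).
  apply: (@bounded_integrable _ _ _ _ eta_fin _ (M%:R ^+ 2)); first exact: measurable_cst.
  by move=> w; rewrite ger0_norm// exprn_ge0.
have [s [c [hs sc]]] := double_limit_subsequence BC.
exists s => // r hr; pose t := s \o r.
have ge_r i : (i <= r i)%N.
  by elim: i => // i IHi; rewrite (leq_ltn_trans IHi)// hr.
have ht : {homo t : i j / (i < j)%N} by move=> i j ij; apply/hs/hr.
apply: weakly_null_cauchy; first exact: (weakly_null_cesaro (weakly_null_sub ht wg)).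
move=> e e0; have e3 : 0 < e / 3 by lra.
have [M hM] := uniformly_ac_tail ug gG e3.
pose T i := g (t i) |^ (~` A M (t i)).
have gT i : `|g (t i) - T i| <= e / 3.
  have /(congr1 (fun x => x - T i)) := restrictC HF (g (t i)) (mA M (t i)).
  by rewrite addrK => <-; exact: hM.
have Bt i j : (M <= i)%N -> (i < j)%N -> `|B M (t i) (t j) - c M| <= 2 / i.+1%:R.
  move=> Mi ij; rewrite (le_trans (sc M (r i) (r j) _ (hr _ _ ij)))//.
    exact: leq_trans Mi (ge_r i).
  by rewrite ler_pM2l// lef_pV2 ?posrE ?ltr0n// ler_nat ltnS ge_r.
have BS i j : B M i j = B M j i by rewrite /B; under eq_Rintegral do rewrite mulrC.
pose K := M%:R ^+ 2 * fine (eta setT).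
have K0 : 0 <= K by rewrite mulr_ge0 ?exprn_ge0// fine_ge0.
(* Indices below [M] escape [Bt]; there the crude bound is used. *)
pose eps i : R := (if (i < M)%N then K + `|c M| else 0) + 2 / i.+1%:R.
have eps0 i : 0 <= eps i by rewrite addr_ge0//; case: ifP => // _; rewrite addr_ge0.
have epscv : eps @ \oo --> (0 : R).
  have h : (fun i => 2 / i.+1%:R : R) @ \oo --> (0 : R).
    by rewrite -[X in _ --> X](mulr0 2); apply: cvgMl_tmp; exact: cvg_harmonic.
  apply: cvg_trans h; apply: near_eq_cvg; exists M => // i /= Mi.
  by rewrite /eps ltnNge Mi/= add0r.
have Beps i j : i != j -> `|B M (t i) (t j) - c M| <= eps i + eps j.
  have lt_case i' j' : (i' < j')%N -> `|B M (t i') (t j') - c M| <= eps i'.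
    move=> ij; rewrite /eps; case: ltnP => Mi; last by rewrite add0r; exact: Bt.
    rewrite ler_wpDr// (le_trans (ler_normB _ _))// lerD2r; exact: BC.
  by rewrite neq_ltn => /orP[ij|ji]; [rewrite ler_wpDr// lt_case|rewrite BS ler_wpDl// lt_case].
have M20 : 0 <= (M%:R + M%:R : R) by rewrite addr_ge0.
have [delta delta0 hdelta] := bounded_small_norm HF acF M20 e3.
have delta4 : 0 < delta / 4 by lra.
have [N hN] := double_mean_cvg eps0 epscv (fun i => BC M (t i) (t i)) Beps delta4.
exists N => n k Nn Nk.
have meanT i : `|cesaro_mean (g \o t) i - cesaro_mean T i| <= e / 3.
  by rewrite -cesaro_meanB; apply: cesaro_mean_norm.
suff : `|cesaro_mean T n - cesaro_mean T k| <= e / 3.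
  have := meanT n; have := meanT k; rewrite -[g \o s \o r]/(g \o t).
  set a := cesaro_mean (g \o t) n; set b := cesaro_mean (g \o t) k.
  set a' := cesaro_mean T n; set b' := cesaro_mean T k => h1 h2 h3.
  have -> : a - b = (a - a') + (a' - b') + (b' - b) by rewrite !addrA !subrK.
  rewrite (le_trans (ler_normD _ _))//; have := ler_normD (a - a') (a' - b').
  by rewrite (distrC b' b); lra.
have TE i : {ae eta, forall w, F (cesaro_mean T i) w =
    pointwise_mean (fun k => u M (t k)) i w}.
  have h : {ae eta, forall w, forall k, F (T k) w = u M (t k) w}.
    by apply: ae_foralln => l; exact: (is_restrict HF (g (t l)) (measurableC (mA M (t l)))).
  apply: filterS2 h (fs_cesaro F T i) => w Tu ->.
  by congr (_ * _); apply: eq_bigr.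
have dE : {ae eta, forall w, F (cesaro_mean T n - cesaro_mean T k) w =
    pointwise_mean (fun k => u M (t k)) n w - pointwise_mean (fun k => u M (t k)) k w}.
  apply: filterS2 (ae_and (TE n) (TE k)) (fsB F (cesaro_mean T n) (cesaro_mean T k)).
  by move=> w [-> ->].
have mdiff : measurable_fun setT (fun w => pointwise_mean (fun k => u M (t k)) n w -
    pointwise_mean (fun k => u M (t k)) k w).
  by apply: measurable_funB; exact: measurable_pointwise_mean.
have bdiff w : `|pointwise_mean (fun k => u M (t k)) n w -
    pointwise_mean (fun k => u M (t k)) k w| <= M%:R + M%:R.
  by rewrite (le_trans (ler_normB _ _))// lerD// (pointwise_mean_bounded (fun i => uM M (t i))).
apply: hdelta; first by apply: filterS dE => w ->; exact: bdiff.
have -> : (\int[eta]_w (F (cesaro_mean T n - cesaro_mean T k)%R w ^+ 2)%:E =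
    \int[eta]_w ((pointwise_mean (fun k => u M (t k)) n w -
    pointwise_mean (fun k => u M (t k)) k w) ^+ 2)%:E)%E.
  apply: ae_eq_integral => //.
  - by apply/measurable_EFinP; apply: measurable_funX; exact: (fs_measurable F).
  - by apply/measurable_EFinP; exact: measurable_funX.
  - by apply: filterS dE => w -> _.
have intd : eta.-integrable setT (EFin \o (fun w => (pointwise_mean (fun k => u M (t k)) n w -
    pointwise_mean (fun k => u M (t k)) k w) ^+ 2)).
  apply: (@bounded_integrable _ _ _ _ eta_fin _ ((M%:R + M%:R) ^+ 2)).
    exact: measurable_funX.
  by move=> w; rewrite normrX lerXn2r ?nnegrE.
rewrite -[X in (X <= _)%E]fineK; last exact: integrable_fin_num.
rewrite lee_fin -/(Rintegral _ _ _).
rewrite (Rintegral_mean_sqr eta_fin (fun i => meas_u M (t i)) (fun i => uM M (t i))).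
have := hN n n Nn Nn; have := hN n k Nn Nk; have := hN k k Nk Nk; rewrite /B.
rewrite !ler_norml => /andP[? ?] /andP[? ?] /andP[? ?]; lra.
Qed.

(** Let [D K] be the part of the supports of [h K, h (K+1), ...] not met by the
    earlier ones. Off [D K] every [g n] with [n >= K] coincides with [f n], and
    restriction preserves weak nullity; the sets [D K] decrease to the empty
    set, so that the [g n] are uniformly small on them. *)
Lemma splitting_weakly_null (f g h : nat -> Z) : weakly_null f ->
  (forall n, f n = g n + h n) -> uniformly_ac_norm F (range g) ->
  (forall i j, i != j -> disjoint_support F (h i) (h j)) ->
  weakly_null g.
Proof.
move=> wf fE ug dh phi.
pose A n := [set s | F (h n) s != 0].
have mA n : measurable (A n).
  exact: (@measurable_neq _ _ _ (F (h n)) (fun=> 0) (fs_measurable F _) (measurable_cst _)).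
pose U K := \bigcup_(k in [set k | (k < K)%N]) A k.
pose D K := (\bigcup_k A k) `\` U K.
have mU K : measurable (U K) by apply: bigcup_measurable => k _.
have mD K : measurable (D K) by apply: measurableD => //; exact: bigcup_measurable.
have eta_fin := is_finite HF.
have Dcv : eta (D K) @[K --> \oo] --> 0%E.
  have D0 : \bigcap_K D K = set0.
    apply/seteqP; split => // s Ds; have [[k _ Aks] _] := Ds 0%N I.
    by have [_] := Ds k.+1 I; apply; exists k => /=.
  rewrite -(measure0 eta) -D0; apply: nonincreasing_cvg_mu => //.
  - by apply: le_lt_trans eta_fin; apply: le_measure => //; rewrite inE.
  - by rewrite D0.
  - apply/nonincreasing_seqP => K; apply/subsetPset => s [As nU]; split => //.
    by move=> [k /= kK Aks]; apply: nU; exists k => //=; exact: ltnW.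
have hD K n : (K <= n)%N -> (h n) |^ (~` D K) = 0.
  move=> Kn; apply: (fs_eq (F := F)).
  have dis : {ae eta, forall s, forall k, (k < K)%N -> F (h k) s = 0 \/ F (h n) s = 0}.
    apply: ae_foralln => k; have [kK|kK] := ltnP k K; last by apply: aeW => s.
    apply: filterS (dh k n _) => [s //|].
    by rewrite neq_ltn (leq_trans kK Kn).
  apply: filterS2 (ae_and (is_restrict HF (h n) (measurableC (mD K))) dis) (fs0 F).
  move=> s [-> dis_s] ->; rewrite patchE; case: ifPn => //.
  rewrite inE /D => nD; have [//|hn0] := eqVneq (F (h n) s) 0.
  apply: contrapT => _; apply: nD; split; first by exists n.
  by move=> [k /= kK /eqP hk0]; have [|] := dis_s k kK => //; exact/eqP.
have phiR K : (fun n => phi ((f n) |^ (~` D K))) @ \oo --> (0 : R).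
  have mDC := measurableC (mD K).
  exact: (weakly_null_operator (restrict_linear HF mDC) (restrict_contract HF mDC) wf).
apply/cvgrPdist_le => e e0; pose e1 := e / 2 / (`|phi| + 1).
have p0 : 0 < `|phi| + 1 by rewrite ltr_pwDr.
have e10 : 0 < e1 by rewrite !divr_gt0.
have [delta delta0 hdelta] := ug _ e10.
have [K DK] : exists K, (eta (D K) < delta%:E)%E.
  have /(_ _)[] := Dcv [set x | (x < delta%:E)%E]; last first.
    by move=> K _ hK; exists K; exact: (hK K (leqnn K)).
  by apply: open_nbhs_nbhs; split; [exact: open_ereal_lt_ereal|rewrite /= lte_fin].
have e2 : 0 < e / 2 by lra.
have /cvgrPdist_le/(_ _ e2)[N _ hN] := phiR K.
exists (maxn K N) => // n /=; rewrite geq_max => /andP[Kn Nn].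
have gE : g n = (g n) |^ (D K) + (f n) |^ (~` D K).
  rewrite -[LHS](restrictC HF (g n) (mD K)); congr (_ + _).
  have := restrict_linear HF (measurableC (mD K)) 1 (g n) (h n).
  by rewrite /= !scale1r -fE hD// addr0.
rewrite sub0r normrN gE linearD /= (le_trans (ler_normD _ _))//.
have := hN n Nn; rewrite /= sub0r normrN.
have gD : `|(g n) |^ (D K)| <= e1 by apply: hdelta => //; exists n.
have : `|phi| * `|(g n) |^ (D K)| <= (`|phi| + 1) * e1.
  by rewrite ler_pM// lerDl.
have -> : (`|phi| + 1) * e1 = e / 2 by rewrite /e1 mulrC divfK// gt_eqF.
by have := dual_le phi ((g n) |^ (D K)); lra.
Qed.

(** Since the supports are disjoint, one function with values in {-1, 0, 1}
    serves as the sign of all the [h n]. *)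
Lemma disjoint_abs_weakly_null (h : nat -> Z) : weakly_null h ->
  (forall i j, i != j -> disjoint_support F (h i) (h j)) ->
  exists2 k : nat -> Z, weakly_null k &
    forall n, {ae eta, forall s, F (k n) s = `|F (h n) s|}.
Proof.
move=> wh dh; pose P := \bigcup_n [set s | 0 < F (h n) s].
pose Q := \bigcup_n [set s | 0 < - F (h n) s].
have mP : measurable P.
  by apply: bigcup_measurable => n _; apply: measurable_gt; exact: (fs_measurable F).
have mQ : measurable Q.
  apply: bigcup_measurable => n _; apply: measurable_gt.
  by apply: measurableT_comp => //; exact: (fs_measurable F).
have wnull A : measurable A -> weakly_null (fun n => (h n) |^ A).
  by move=> mA; exact: (weakly_null_operator (restrict_linear HF mA) (restrict_contract HF mA) wh).
exists (fun n => (h n) |^ P - (h n) |^ Q); first exact: weakly_nullB (wnull _ mP) (wnull _ mQ).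
move=> n; have dis : {ae eta, forall s, forall k, k != n -> F (h k) s = 0 \/ F (h n) s = 0}.
  apply: ae_foralln => k; have [->|kn] := eqVneq k n; first by apply: aeW => s.
  by apply: filterS (dh k n kn) => s.
have hPQ := ae_and (is_restrict HF (h n) mP) (is_restrict HF (h n) mQ).
apply: filterS2 (ae_and hPQ dis) (fsB F ((h n) |^ P) ((h n) |^ Q)).
move=> s [[hP hQ] dis_s] ->; rewrite hP hQ !patchE.
have only k : F (h n) s != 0 -> F (h k) s != 0 -> k = n.
  move=> hn hk; apply/eqP/negPn/negP => kn.
  by have [] := dis_s k kn; apply/eqP.
have [hn0|hn0|hn0] := ltrgt0P (F (h n) s).
- rewrite mem_set; last by exists n.
  rewrite memNset ?subr0// => -[k _ /= hk].
  have kn : k = n by apply: only; [rewrite gt_eqF|rewrite lt_eqF// -oppr_gt0].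
  by move: hk; rewrite kn; lra.
- rewrite memNset; last first.
    move=> [k _ /= hk].
    have kn : k = n by apply: only; [rewrite lt_eqF|rewrite gt_eqF].
    by move: hk; rewrite kn; lra.
  by rewrite mem_set ?sub0r//; exists n => //=; lra.
- by rewrite hn0; do 2 case: ifP => _; rewrite subr0.
Qed.

End sequences_in_intermediate_space.

(** * Positive functionals on a Banach function space *)

Section banach_function_space_theory.
Context {R : realType} d (S : measurableType d) (rho : {measure set S -> \bar R}).
Context (X : completeNormedModType R) (F : banach_function_space rho X).
Implicit Types (x y z : X).

Lemma bfs_monotone y z : {ae rho, forall s, `|F y s| <= `|F z s|} -> `|y| <= `|z|.
Proof.
move=> yz; have [y' [y'E ny']] := bfs_ideal (fs_measurable F y) yz.
by rewrite -(fs_eq (F := F) y'E).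
Qed.

Lemma bfs_pos_part_ex x : exists y, {ae rho, forall s, F y s = Num.max (F x s) 0}.
Proof.
have mx : measurable_fun setT (fun s => Num.max (F x s) 0).
  by apply: measurable_maxr; [exact: fs_measurable|exact: measurable_cst].
have lex : {ae rho, forall s, `|Num.max (F x s) 0| <= `|F x s|}.
  apply: aeW => s; rewrite ger0_norm ?le_max ?lexx ?orbT//.
  by rewrite ge_max ler_norm normr_ge0.
by have [y [yE _]] := bfs_ideal mx lex; exists y.
Qed.

Definition pos_part x : X := sval (cid (bfs_pos_part_ex x)).

Lemma pos_partE x : {ae rho, forall s, F (pos_part x) s = Num.max (F x s) 0}.
Proof. exact: svalP (cid (bfs_pos_part_ex x)). Qed.

Lemma sublinear_pos_part : sublinear (fun x => `|pos_part x|).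
Proof.
split => [x y|a x a0].
  apply: le_trans (ler_normD _ _); apply: bfs_monotone.
  have h := ae_and (pos_partE (x + y)) (ae_and (pos_partE x) (pos_partE y)).
  apply: filterS2 (ae_and h (fsD F x y)) (fsD F (pos_part x) (pos_part y)).
  move=> s [[-> [xE yE]] ->] ->; rewrite xE yE.
  have m0 (a : R) : 0 <= Num.max a 0 by rewrite le_max lexx orbT.
  have ma (a : R) : a <= Num.max a 0 by rewrite le_max lexx.
  by rewrite !ger0_norm ?addr_ge0// ge_max addr_ge0 ?lerD.
rewrite -[X in X * _](ger0_norm a0) -normrZ; congr `| _ |.
apply: (fs_eq (F := F)); have h := ae_and (pos_partE (a *: x)) (pos_partE x).
apply: filterS2 (ae_and h (fsZ F a x)) (fsZ F a (pos_part x)).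
by move=> s [[-> xE] ->] ->; rewrite xE maxr_pMr// mulr0.
Qed.

(** Hahn-Banach for the sublinear functional x |-> |x^+|, which vanishes on
    negative elements, so that the functionals below it are positive. *)
Lemma ge0_positive_functionals v :
  (forall psi : cdual X, `|psi| <= 1 -> (forall x, fs_ge0 F x -> 0 <= psi x) ->
     0 <= psi v) -> fs_ge0 F v.
Proof.
move=> vge; have [f [lf fp fv]] := hahn_banach (- v) sublinear_pos_part.
have fn x : f x <= `|x|.
  apply: le_trans (fp x) _; apply: bfs_monotone.
  apply: filterS (pos_partE x) => s ->; rewrite ger0_norm ?le_max ?lexx ?orbT//.
  by rewrite ge_max ler_norm normr_ge0.
have [psi [psi1 psiE]] := dominated_functional lf fn.
have psi0 x : fs_ge0 F x -> 0 <= psi x.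
  move=> x0; have pos0 : pos_part (- x) = 0.
    apply: (fs_eq (F := F)); apply: filterS2 (ae_and (pos_partE (- x)) (fsN F x)) (ae_and (fs0 F) x0).
    by move=> s [-> ->] [-> x0s]; rewrite max_r// oppr_le0.
  by have := fp (- x); rewrite pos0 normr0 -psiE linearN /= oppr_le0.
have := vge psi psi1 psi0; have := psiE (- v); rewrite fv linearN /= => pN v0.
have pv0 : pos_part (- v) = 0.
  by apply/eqP; rewrite -normr_le0 -pN oppr_le0.
have := pos_partE (- v); rewrite pv0 => h.
apply: filterS2 (ae_and h (fs0 F)) (fsN F v) => s [h1 h2] h3.
by move: h1; rewrite h2 h3 => h1; rewrite -oppr_le0 h1 le_max lexx.
Qed.

End banach_function_space_theory.

(** * Integration against a vector measure *)

Section scalar_integral_theory.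
Context {R : realType} d (Omega : measurableType d) (X : normedModType R).
Variable m : vector_measure Omega X.
Implicit Types (phi psi : cdual X) (f g : Omega -> R) (A : set Omega).

Local Notation var phi := (scalar_variation m phi).
Local Notation jp phi := (jordan_pos (hahn_posneg m phi)).
Local Notation jn phi := (jordan_neg (hahn_posneg m phi)).

Lemma scalar_variation_fin phi : (var phi setT < +oo)%E.
Proof.
have -> : var phi setT = (jp phi setT + jn phi setT)%E by [].
by rewrite ltey_eq fin_numD !fin_num_measure.
Qed.

Lemma Rintegral_scalar_variation phi f : (var phi).-integrable setT (EFin \o f) ->
  \int[var phi]_w `|f w| = \int[jp phi]_w `|f w| + \int[jn phi]_w `|f w|.
Proof.
move=> fi; have [fp fn] := scalar_variation_integrable fi.
have mf : measurable_fun setT f by apply/measurable_EFinP; exact: measurable_int fi.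
rewrite /Rintegral integral_scalar_variation//; last first.
  by apply/measurable_EFinP; exact: measurableT_comp.
by rewrite fineD//; apply: integrable_fin_num => //; exact: integrable_norm.
Qed.

Lemma scalar_integral_le phi f A : (var phi).-integrable setT (EFin \o f) ->
  measurable A -> `|scalar_integral m phi A f| <= \int[var phi]_w `|f w|.
Proof.
move=> fi mA; rewrite Rintegral_scalar_variation//.
have [fp fn] := scalar_variation_integrable fi.
have le_sub (mu : {measure set Omega -> \bar R}) : mu.-integrable setT (EFin \o f) ->
    `|\int[mu]_(w in A) f w| <= \int[mu]_w `|f w|.
  move=> fmu; have fA := integrableS measurableT mA (@subsetT _ A) fmu.
  rewrite (le_trans (le_normr_Rintegral mA fA))//.
  rewrite /Rintegral fine_le//.
  - by apply: integrable_fin_num => //; exact: integrable_norm.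
  - by apply: integrable_fin_num => //; exact: integrable_norm.
  - by apply: ge0_subset_integral => //; exact: measurable_int (integrable_norm fmu).
by rewrite (le_trans (ler_normB _ _))// lerD// le_sub.
Qed.

Lemma scalar_integral_linear phi (a : R) f g :
  (var phi).-integrable setT (EFin \o f) -> (var phi).-integrable setT (EFin \o g) ->
  scalar_integral m phi setT (fun w => a * f w + g w) =
  a * scalar_integral m phi setT f + scalar_integral m phi setT g.
Proof.
move=> fi gi; have [fp fn] := scalar_variation_integrable fi.
have [gp gn] := scalar_variation_integrable gi.
have lin (mu : {measure set Omega -> \bar R}) : mu.-integrable setT (EFin \o f) ->
    mu.-integrable setT (EFin \o g) ->
    \int[mu]_w (a * f w + g w) = a * \int[mu]_w f w + \int[mu]_w g w.
  move=> fmu gmu; rewrite -RintegralZl// -RintegralD//.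
  exact: (integrableZl measurableT a fmu).
by rewrite /scalar_integral !lin//; ring.
Qed.

Lemma scalar_integral_ae phi f g :
  (var phi).-integrable setT (EFin \o f) -> (var phi).-integrable setT (EFin \o g) ->
  {ae var phi, forall w, f w = g w} ->
  scalar_integral m phi setT f = scalar_integral m phi setT g.
Proof.
move=> fi gi fg.
have hi : (var phi).-integrable setT (EFin \o (fun w => -1 * f w + g w)).
  exact: (integrableD measurableT (integrableZl measurableT (-1) fi) gi).
have h0 : \int[var phi]_w `|-1 * f w + g w| = 0.
  rewrite /Rintegral (ae_eq_integral (cst 0%E))//.
  - by rewrite integral0.
  - exact: measurable_int (integrable_norm hi).
  - by apply: filterS fg => w -> _; rewrite mulN1r addNr normr0.
have := scalar_integral_le hi measurableT; rewrite h0 scalar_integral_linear// normr_le0.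
by rewrite mulN1r addrC subr_eq0 => /eqP.
Qed.

Lemma Rintegral_null (mu : {measure set Omega -> \bar R}) f A : measurable A ->
  measurable_fun setT f -> mu A = 0%E -> \int[mu]_(w in A) f w = 0.
Proof.
move=> mA mf muA; rewrite /Rintegral null_set_integral//.
by apply: measurable_funTS; exact/measurable_EFinP.
Qed.

Lemma Rintegral_conull (mu : {measure set Omega -> \bar R}) f P N :
  measurable P -> measurable N -> P `|` N = setT -> P `&` N = set0 ->
  mu N = 0%E -> mu.-integrable setT (EFin \o f) ->
  \int[mu]_(w in P) f w = \int[mu]_w f w.
Proof.
move=> mP mN PN PN0 muN fi.
rewrite -PN Rintegral_setU//; last 2 first.
- by rewrite PN.
- by apply/disj_setPS; rewrite PN0.
rewrite (Rintegral_null mN _ muN) ?addr0//.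
by apply/measurable_EFinP; exact: measurable_int fi.
Qed.

Lemma scalar_integral_restrict phi f A :
  scalar_integral m phi setT (f \_ A) = scalar_integral m phi A f.
Proof. by rewrite /scalar_integral -!Rintegral_mkcond. Qed.

(** The variation integrates [f] with the signs of a Hahn decomposition. *)
Lemma scalar_integral_hahn phi f : (var phi).-integrable setT (EFin \o f) ->
  (forall w, 0 <= f w) ->
  \int[var phi]_w `|f w| = scalar_integral m phi (hahn_pos m phi) f -
                      scalar_integral m phi (hahn_neg m phi) f.
Proof.
move=> fi f0; rewrite Rintegral_scalar_variation//.
have [fp fn] := scalar_variation_integrable fi.
have [[mP _] [mN _] PNT PN0] := hahn_posneg m phi.
have mf : measurable_fun setT f by apply/measurable_EFinP; exact: measurable_int fi.
rewrite /scalar_integral (Rintegral_null mN mf (jordan_pos_neg0 m phi)).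
rewrite (Rintegral_null mP mf (jordan_neg_pos0 m phi)) subr0 sub0r opprK.
rewrite (Rintegral_conull mP mN PNT PN0 (jordan_pos_neg0 m phi) fp).
rewrite (Rintegral_conull mN mP _ _ (jordan_neg_pos0 m phi) fn) 1?setUC 1?setIC//.
by congr (_ + _); apply: eq_Rintegral => w _; rewrite ger0_norm.
Qed.

Lemma scalar_integral_cst1 phi A : measurable A ->
  scalar_integral m phi A (fun=> 1) = phi (m A).
Proof.
move=> mA; rewrite /scalar_integral !Rintegral_cst// !mul1r.
have /(congr1 fine) /= := jordan_decomp (hahn_posneg m phi) mA.
rewrite /cadd /= cscaleN1 /scalar_measure fineD ?fin_numN ?fin_num_measure//=.
by rewrite fineN => ->.
Qed.

(** The negative part of a nonnegative charge vanishes, whichever Hahn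
    decomposition has been chosen. *)
Lemma scalar_integral_ge0 phi f : (forall A, measurable A -> 0 <= phi (m A)) ->
  measurable_fun setT f -> (forall w, 0 <= f w) -> 0 <= scalar_integral m phi setT f.
Proof.
move=> phi0 mf f0.
have jn0 : jn phi setT = 0%E.
  have [_ [mN _] _ _] := hahn_posneg m phi.
  apply/eqP; rewrite eq_le measure_ge0 andbT.
  rewrite jordan_negE /= charge.cjordan_negE /crestr0 mem_set// /crestr setTI.
  by rewrite /scalar_measure leeNl oppe0 lee_fin phi0.
by rewrite /scalar_integral (Rintegral_null measurableT mf jn0) subr0 Rintegral_ge0.
Qed.

Lemma vm_integrable_cst1 : vm_integrable m (fun=> 1).
Proof.
split; first exact: measurable_cst.
  move=> phi; apply: (@bounded_integrable _ _ _ _ (scalar_variation_fin phi) _ 1).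
    exact: measurable_cst.
  by move=> w; rewrite normr1.
by move=> A mA; exists (m A) => phi; rewrite scalar_integral_cst1.
Qed.

End scalar_integral_theory.

(** * The space L^1(m) over a Rybakov measure *)

Section L1_theory.
Context {R : realType} d (Omega : measurableType d) (X : normedModType R).
Variable m : vector_measure Omega X.
Variables (phi : cdual X) (ryb : rybakov m phi).
Implicit Types (psi : cdual X) (z : L1 m) (A : set Omega).

Local Notation var psi := (scalar_variation m psi).
Local Notation F := (L1_function_space ryb).

Lemma rybakov_ae A psi : measurable A -> {ae var phi, forall w, A w} ->
  `|psi| <= 1 -> {ae var psi, forall w, A w}.
Proof.
move=> mA Aae psi1; have mC := measurableC mA.
have phi0 : var phi (~` A) = 0%E by apply/negligibleP.
have /semivariation0P/(_ psi psi1) psi0 := (ryb mC).1 phi0.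
by apply/negligibleP.
Qed.

Lemma L1_repr_integrable psi z : (var psi).-integrable setT (EFin \o L1_repr z).
Proof. by have [] := L1fun_integrable (L1_repr z). Qed.

Lemma L1_normP z (b : R) :
  (forall psi, `|psi| <= 1 -> \int[var psi]_w `|L1_repr z w| <= b) <-> `|z| <= b.
Proof.
have E psi : ((\int[var psi]_w `|L1_repr z w|)%:E =
    \int[var psi]_w `|(L1_repr z w)%:E|)%E.
  rewrite /Rintegral fineK//; apply: integrable_fin_num => //.
  exact: (integrable_norm (L1_repr_integrable psi z)).
split => [h|zb psi psi1].
  rewrite -lee_fin L1_normE; apply: ge_ereal_sup => _ [psi /= psi1 <-].
  by rewrite -E lee_fin h.
rewrite -lee_fin (le_trans _ (_ : (`|z|%:E <= b%:E)%E))// E L1_normE.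
by apply: ereal_sup_ubound; exists psi.
Qed.

Lemma L1_repr_ae z (f : Omega -> R) psi : measurable_fun setT f ->
  {ae var phi, forall w, F z w = f w} -> `|psi| <= 1 ->
  {ae var psi, forall w, L1_repr z w = f w}.
Proof.
move=> mf zf psi1.
apply: (@rybakov_ae [set w | L1_repr z w = f w] _ _ zf psi1).
rewrite (_ : [set w | _] = ~` [set w | L1_repr z w != f w]).
  exact: measurableC (measurable_neq (L1fun_measurable _) mf).
by apply/seteqP; split => w /=; [move=> ->; rewrite eqxx|move/negP; rewrite negbK => /eqP].
Qed.

Lemma L1_ae_ge0 z psi : fs_ge0 F z -> `|psi| <= 1 ->
  {ae var psi, forall w, 0 <= L1_repr z w}.
Proof.
move=> z0 psi1; apply: (@rybakov_ae [set w | 0 <= L1_repr z w] _ _ z0 psi1).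
rewrite (_ : [set w | _] = L1_repr z @^-1` `[0, +oo[).
  by rewrite -[X in measurable X]setTI; exact: (L1fun_measurable (L1_repr z)).
by apply/seteqP; split => w /=; rewrite in_itv/= andbT.
Qed.

Lemma L1_monotone (y z : L1 m) :
  {ae var phi, forall w, `|F y w| <= `|F z w|} -> `|y| <= `|z|.
Proof.
move=> yz; apply/L1_normP => psi psi1.
have mabs (x : L1 m) : measurable_fun setT (fun w => `|L1_repr x w|).
  by apply: measurableT_comp => //; exact: L1fun_measurable.
have yz' : {ae var psi, forall w, `|L1_repr y w| <= `|L1_repr z w|}.
  apply: (@rybakov_ae [set w | `|L1_repr y w| <= `|L1_repr z w|] _ _ yz psi1).
  rewrite (_ : [set w | _] = ~` [set w | 0 < `|L1_repr y w| - `|L1_repr z w|]).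
    by apply/measurableC/measurable_gt; exact: measurable_funB.
  by apply/seteqP; split => w /=; rewrite subr_gt0 leNgt => /negP.
apply: le_trans ((L1_normP z `|z|).2 (lexx _) psi psi1).
have iabs (x : L1 m) := integrable_norm (L1_repr_integrable psi x).
rewrite /Rintegral; apply: fine_le.
- exact: (integrable_fin_num measurableT (iabs y)).
- exact: (integrable_fin_num measurableT (iabs z)).
apply: ae_ge0_le_integral => //.
- exact/measurable_EFinP.
- exact/measurable_EFinP.
- by apply: filterS yz' => w h _; rewrite lee_fin.
Qed.

Lemma L1_vector_integral_ex z : exists v : X,
  forall psi, psi v = scalar_integral m psi setT (L1_repr z).
Proof. by have [_ _] := L1fun_integrable (L1_repr z); exact. Qed.

Definition vector_integral z : X := sval (cid (L1_vector_integral_ex z)).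

Lemma vector_integralE z psi :
  psi (vector_integral z) = scalar_integral m psi setT (L1_repr z).
Proof. exact: svalP (cid (L1_vector_integral_ex z)) psi. Qed.

Lemma vector_integral_linear : linear vector_integral.
Proof.
move=> a y z; apply: separate_points => psi psi1.
have yi := L1_repr_integrable psi y; have zi := L1_repr_integrable psi z.
rewrite linearP /= !vector_integralE -(scalar_integral_linear a yi zi).
apply: scalar_integral_ae; first exact: L1_repr_integrable.
  exact: (integrableD measurableT (integrableZl measurableT a yi) zi).
apply: L1_repr_ae => //; last exact: (fs_linearE F a y z).
by apply: measurable_funD; [apply: measurable_funM => //|]; exact: L1fun_measurable.
Qed.

Lemma vector_integral_le z : `|vector_integral z| <= 1 * `|z|.
Proof.
rewrite mul1r; have [psi psi1 <-] := norming_functional (vector_integral z).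
rewrite vector_integralE; apply: le_trans (ler_norm _) _.
apply: le_trans ((L1_normP z `|z|).2 (lexx _) psi psi1).
by apply: scalar_integral_le => //; exact: L1_repr_integrable.
Qed.

Lemma vector_integral_restrict z A psi : measurable A -> `|psi| <= 1 ->
  psi (vector_integral (fs_restrict F z A)) = scalar_integral m psi A (L1_repr z).
Proof.
move=> mA psi1; rewrite vector_integralE -[RHS]scalar_integral_restrict.
apply: scalar_integral_ae; first exact: L1_repr_integrable.
  by rewrite -restrict_EFin; apply/(integrable_mkcond _ mA);
    apply: integrableS (L1_repr_integrable psi z).
apply: L1_repr_ae psi1; last exact: (L1_restrictP ryb z mA).
exact: (measurable_restrictT _ mA).1 (measurable_funTS (L1fun_measurable _)).
Qed.

Lemma vector_integral_ge0 z psi : `|psi| <= 1 -> fs_ge0 F z ->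
  (forall A, measurable A -> 0 <= psi (m A)) -> 0 <= psi (vector_integral z).
Proof.
move=> psi1 z0 pos; rewrite vector_integralE.
have mz := L1fun_measurable (L1_repr z).
rewrite (@scalar_integral_ae _ _ _ _ _ _ _ (fun w => `|L1_repr z w|)).
- by apply: scalar_integral_ge0 => //; exact: measurableT_comp.
- exact: L1_repr_integrable.
- exact: (integrable_norm (L1_repr_integrable psi z)).
- by apply: filterS (L1_ae_ge0 z0 psi1) => w h; rewrite ger0_norm.
Qed.

(** By [integral_abs_le] it suffices to bound the integrals over all sets, for
    which the vectors representing them have norm at most [`|z|]. The factor 4
    comes from splitting by a Hahn decomposition and then by the sign of [z]. *)
Lemma L1_embedding z : (\int[var phi]_w `|F z w|%:E <= (4 * `|phi| * `|z|)%:E)%E.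
Proof.
have [mf vf intf] := L1fun_integrable (L1_repr z).
have [fp fn] := scalar_variation_integrable (vf phi).
have bound A : measurable A -> `|scalar_integral m phi A (L1_repr z)| <= `|phi| * `|z|.
  move=> mA; have [v vE] := intf A mA; rewrite -vE (le_trans (dual_le _ _))//.
  rewrite ler_wpM2l//; have [psi psi1 <-] := norming_functional v.
  rewrite vE; apply: le_trans (ler_norm _) _.
  apply: le_trans ((L1_normP z `|z|).2 (lexx _) psi psi1).
  by apply: scalar_integral_le => //; exact: vf.
have [[mP _] [mN _] PNT PN0] := hahn_posneg m phi.
rewrite integral_scalar_variation//; last exact: measurable_abseE.
rewrite (_ : 4 * `|phi| * `|z| = (`|phi| * `|z| + `|phi| * `|z|) +
  (`|phi| * `|z| + `|phi| * `|z|)); last by ring.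
rewrite EFinD leeD//.
- apply: (integral_abs_le mP mN PNT PN0 _ _ fp).
  + exact: jordan_pos_neg0.
  + exact: jordan_neg_pos0.
  + by move=> A mA; exact: bound.
- apply: (@integral_abs_le _ _ _ _ (jordan_pos (hahn_posneg m phi)) _ _ _ _ mN mP) => //.
  + by rewrite setUC.
  + by rewrite setIC.
  + exact: jordan_neg_pos0.
  + exact: jordan_pos_neg0.
  + by move=> A mA; rewrite distrC; exact: bound.
Qed.

Lemma L1_intermediate_space : intermediate_space F.
Proof.
split; [exact: scalar_variation_fin|exact: L1_monotone|exact: L1_restrictP| |].
- have u1 : (fun=> 1 : R) \in L1_pred m by apply/asboolP; exact: vm_integrable_cst1.
  exists (L1_class (L1Fun u1)); apply/(rybakov_aeP ryb).
  + exact: L1fun_measurable.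
  + exact: measurable_cst.
  + exact: (L1_class_repr (L1Fun u1)).
- by exists (4 * `|phi|) => [|z]; [rewrite mulr_ge0|exact: L1_embedding].
Qed.

End L1_theory.

(** * Positive vector measures *)

Section positive_vector_measure.
Context {R : realType} dS (S : measurableType dS) (rho : {measure set S -> \bar R}).
Context (X : completeNormedModType R) (XF : banach_function_space rho X).
Context dO (Omega : measurableType dO) (m : vector_measure Omega X).
Hypothesis m_pos : vm_positive m XF.
Variables (phi : cdual X) (ryb : rybakov m phi).

Local Notation F := (L1_function_space ryb).

(** With [P] and [N] a Hahn decomposition for [psi m], the integral of [z]
    against the variation of [psi m] is the value of [psi] at the integral v' of
    [y], where [y] is [z] on [P] and [- z] on [N]. Since [z - y] and [z + y] are
    nonnegative and [m] is positive, v' lies between - v and v, with v the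
    integral of [z], whence the bound on its norm. *)
Lemma norm_le_vector_integral (z : L1 m) : fs_ge0 F z ->
  `|z| <= `|vector_integral z|.
Proof.
move=> z0; have HF := L1_intermediate_space ryb.
apply/L1_normP => psi psi1; have [[mP _] [mN _] _ _] := hahn_posneg m psi.
set P := hahn_pos m psi in mP *; set N := hahn_neg m psi in mN *.
pose y := fs_restrict F z P - fs_restrict F z N.
have viB (a b : L1 m) : vector_integral (a - b) = vector_integral a - vector_integral b.
  have := vector_integral_linear (m := m) ryb (-1) b a.
  by rewrite !scaleN1r => h; rewrite addrC h addrC.
have viD (a b : L1 m) : vector_integral (a + b) = vector_integral a + vector_integral b.
  by have := vector_integral_linear (m := m) ryb 1 a b; rewrite !scale1r.
have yE : {ae scalar_variation m phi, forall w,
    F y w = (F z \_ P) w - (F z \_ N) w}.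
  have h := ae_and (is_restrict HF z mP) (is_restrict HF z mN).
  by apply: filterS2 h (fsB F (fs_restrict F z P) (fs_restrict F z N)) => w [-> ->].
have posX x : fs_ge0 F x -> fs_ge0 XF (vector_integral x).
  move=> x0; apply: ge0_positive_functionals => chi chi1 chi0.
  by apply: vector_integral_ge0 x0 _ => // A mA; apply: chi0; exact: m_pos.
have yz : {ae scalar_variation m phi, forall w, 0 <= F (z - y) w /\ 0 <= F (z + y) w}.
  apply: filterS2 (ae_and yE z0) (ae_and (fsB F z y) (fsD F z y)) => w [yw zw] [-> ->].
  have restrE A : (F z \_ A) w = if w \in A then F z w else 0 by [].
  by rewrite yw !restrE; case: ifP; case: ifP => _ _; lra.
have vB : fs_ge0 XF (vector_integral (z - y)) by apply: posX; apply: filterS yz => w [].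
have vD : fs_ge0 XF (vector_integral (z + y)) by apply: posX; apply: filterS yz => w [].
have vy : `|vector_integral y| <= `|vector_integral z|.
  apply: (bfs_monotone (F := XF)); rewrite viB in vB; rewrite viD in vD.
  have h1 := ae_and vB (fsB XF (vector_integral z) (vector_integral y)).
  have h2 := ae_and vD (fsD XF (vector_integral z) (vector_integral y)).
  apply: filterS2 h1 h2 => s [Bs BE] [Ds DE]; rewrite BE in Bs; rewrite DE in Ds.
  by apply: le_trans (ler_norm _); rewrite ler_norml; apply/andP; split; lra.
apply: le_trans vy; apply: le_trans (_ : psi (vector_integral y) <= _); last first.
  apply: le_trans (ler_norm _) _; apply: le_trans (dual_le _ _) _.
  by rewrite ler_piMl.
rewrite viB linearB /= !vector_integral_restrict//.
have zi := L1_repr_integrable psi z; have zai := integrable_norm zi.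
have zabs := L1_ae_ge0 z0 psi1.
have restr A : measurable A -> scalar_integral m psi A (L1_repr z) =
    scalar_integral m psi A (fun w => `|L1_repr z w|).
  move=> mA; rewrite -[LHS]scalar_integral_restrict -[RHS]scalar_integral_restrict.
  apply: scalar_integral_ae.
  - by rewrite -restrict_EFin; apply/(integrable_mkcond _ mA); apply: integrableS zi.
  - by rewrite -restrict_EFin; apply/(integrable_mkcond _ mA); apply: integrableS zai.
  - by apply: filterS zabs => w h; rewrite !patchE ger0_norm.
rewrite !restr// -scalar_integral_hahn//.
by under [leRHS]eq_Rintegral do rewrite normr_id.
Qed.

End positive_vector_measure.

Theorem theorem5 (R : realType)
    (dS : measure_display) (S : measurableType dS)
    (rho : {measure set S -> \bar R})
    (X : completeNormedModType R) (XF : banach_function_space rho X)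
    (dO : measure_display) (Omega : measurableType dO)
    (m : vector_measure Omega X) :
  weak_banach_saks X ->
  vm_separable m /\ vm_positive m XF ->
  forall (phi : cdual X) (ryb : rybakov m phi),
  subsequence_splitting (L1_function_space ryb) ->
  weak_banach_saks (L1 m).
Proof.
move=> wbsX [_ m_pos] phi ryb [acF split_f] f wf.
have HF := L1_intermediate_space ryb; set F := L1_function_space ryb in HF acF split_f.
have [s0 [g [h [hs0 fE ug dh]]]] := split_f f (weakly_null_bounded wf).
have wfs := weakly_null_sub hs0 wf.
have wg := splitting_weakly_null HF wfs (fun n => (fE n).1) ug dh.
have wh : weakly_null h.
  rewrite (_ : h = fun n => f (s0 n) - g n); first exact: weakly_nullB.
  by apply/funext => n; rewrite (fE n).1 addrC addKr.
have [s1 hs1 cg] := uniformly_ac_cesaro HF acF wg ug.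
have wh1 := weakly_null_sub hs1 wh.
have dh1 i j : i != j -> disjoint_support F (h (s1 i)) (h (s1 j)).
  move=> ij; apply: dh; apply: contra ij => /eqP sij; apply/eqP.
  by case: (ltngtP i j) => // /hs1; rewrite sij ltnn.
have [k wk kE] := disjoint_abs_weakly_null HF wh1 dh1.
have wv := weakly_null_operator (vector_integral_linear ryb) (@vector_integral_le _ _ _ _ m) wk.
(* The last extraction serves the [h n]; the [g n] allow for it by the choice of [s1]. *)
have [s2 hs2 cv] := wbsX _ wv.
exists (s0 \o s1 \o s2); first by move=> i j ij; apply/hs0/hs1/hs2.
have ch : cesaro_mean (h \o s1 \o s2) @ \oo --> (0 : L1 m).
  apply/cvgrPdist_le => e e0; have /cvgrPdist_le/(_ e e0)[N _ hN] := cv.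
  exists N => // n Nn; rewrite sub0r normrN; have := hN n Nn; rewrite sub0r normrN.
  apply: le_trans.
  have kall : {ae scalar_variation m phi, forall w, forall i, F (k i) w = `|F (h (s1 i)) w|}.
    exact: ae_foralln.
  apply: (@le_trans _ _ `|cesaro_mean (k \o s2) n|).
    apply: (is_monotone HF).
    have hc := ae_and (fs_cesaro F (k \o s2) n) (fs_cesaro F (h \o s1 \o s2) n).
    apply: filterS2 hc kall => w [-> ->] kw.
    have kge0 i : 0 <= F (k i) w by rewrite kw.
    have kgeh i : `|F (h (s1 i)) w| <= F (k i) w by rewrite kw.
    rewrite [leRHS]ger0_norm; last first.
      by rewrite mulr_ge0// sumr_ge0// => i _; exact: kge0.
    rewrite /pointwise_mean normrM ger0_norm// ler_wpM2l//.
    by rewrite (le_trans (ler_norm_sum _ _ _))// ler_sum// => i _; exact: kgeh.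
  have kge0 : fs_ge0 F (cesaro_mean (k \o s2) n).
    apply: filterS2 (fs_cesaro F (k \o s2) n) kall => w -> kw.
    have kge0 i : 0 <= F (k i) w by rewrite kw.
    by rewrite mulr_ge0// sumr_ge0// => i _; exact: kge0.
  have := norm_le_vector_integral m_pos kge0.
  pose V : {linear L1 m -> X} := HB.pack (vector_integral (m := m))
    (GRing.isLinear.Build _ _ _ _ _ (vector_integral_linear ryb)).
  rewrite (_ : vector_integral _ = n.+1%:R^-1 *: \sum_(i < n.+1) vector_integral (k (s2 i)))//.
  by rewrite -[LHS]/(V _) /cesaro_mean linearZ linear_sum.
have -> : (fun n => n.+1%:R^-1 *: \sum_(k < n.+1) f ((s0 \o s1 \o s2) k)) =
    (fun n => cesaro_mean (g \o s1 \o s2) n + cesaro_mean (h \o s1 \o s2) n).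
  apply/funext => n; rewrite -cesaro_meanD /cesaro_mean; congr (_ *: _).
  by apply: eq_bigr => i _; rewrite (fE _).1.
by have cgh := cvgD (cg s2 hs2) ch; rewrite addr0 in cgh; exact: cgh.
Qed.
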